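(* The functor $\mathbf{\Lambda}$ is an isomorphism of categories from the category of reflexive diffeological spaces (with diffeologically smooth maps) to the category of Frölicher spaces (with Frölicher smooth maps), with inverse functor given by $\mathbf{\Pi}\circ\mathbf{\Xi}$.
   Context: Diffeology. A parametrisation of a nonempty set $X$ is a function $p:U\to X$ with $U$ an open subset of some $\mathbb{R}^n$. A diffeology $\mathcal{D}$ on $X$ is a set of parametrisations (plots) such that: (1) for every $x\in X$ and every integer $n\ge 0$ the constant map $\mathbb{R}^n\to\{x\}\subseteq X$ is in $\mathcal{D}$; (2) if $p:U\to X$ is a parametrisation such that every $u\in U$ has an open neighbourhood $V\subseteq U$ with $p|_V\in\mathcal{D}$, then $p\in\mathcal{D}$; (3) if $(p:U\to X)\in\mathcal{D}$, $V\subseteq\mathbb{R}^n$ is open (any $n$) and $F:V\to U$ is smooth, then $p\circ F\in\mathcal{D}$. A map $F:(X,\mathcal{D}_X)\to(Y,\mathcal{D}_Y)$ is diffeologically smooth if $F\circ p\in\mathcal{D}_Y$ for all $p\in\mathcal{D}_X$. Differential structure. A differential structure on a nonempty set $X$ is a nonempty family $\mathcal{F}$ of functions $X\to\mathbb{R}$, together with the weakest topology making every element of $\mathcal{F}$ continuous, such that: (1) for $f_1,\dots,f_k\in\mathcal{F}$ and $F\in C^\infty(\mathbb{R}^k)$, $F(f_1,\dots,f_k)\in\mathcal{F}$; (2) if $f:X\to\mathbb{R}$ is such that every $x\in X$ has an open neighbourhood $U$ and some $g\in\mathcal{F}$ with $f|_U=g|_U$, then $f\in\mathcal{F}$. A map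 $F:(X,\mathcal{F}_X)\to(Y,\mathcal{F}_Y)$ is functionally smooth if $f\circ F\in\mathcal{F}_X$ for all $f\in\mathcal{F}_Y$. Operators. For a set $\mathcal{D}_0$ of parametrisations into $X$ (in particular for a set $\mathcal{C}_0$ of curves $\mathbb{R}\to X$) let $\Phi\mathcal{D}_0=\{f:X\to\mathbb{R}\mid f\circ p \text{ is smooth } \forall p\in\mathcal{D}_0\}$. For a set $\mathcal{F}_0$ of functions $X\to\mathbb{R}$ let $\Pi\mathcal{F}_0=\{\text{parametrisations }p \text{ of } X\mid f\circ p\text{ is smooth }\forall f\in\mathcal{F}_0\}$ and $\Gamma\mathcal{F}_0=\{c:\mathbb{R}\to X\mid f\circ c\in C^\infty(\mathbb{R})\ \forall f\in\mathcal{F}_0\}$. A diffeology $\mathcal{D}$ is reflexive if $\Pi\Phi\mathcal{D}=\mathcal{D}$; a differential structure $\mathcal{F}$ is reflexive if $\Phi\Pi\mathcal{F}=\mathcal{F}$. Frölicher spaces. A Frölicher space is a triple $(X,\mathcal{C},\mathcal{F})$ with $\mathcal{C}$ a family of curves $\mathbb{R}\to X$ and $\mathcal{F}$ a family of functions $X\to\mathbb{R}$ such that $\Phi\mathcal{C}=\mathcal{F}$ and $\Gamma\mathcal{F}=\mathcal{C}$. A map $F:(X,\mathcal{C}_X,\mathcal{F}_X)\to(Y,\mathcal{C}_Y,\mathcal{F}_Y)$ is Frölicher smooth if $f\circ F\in\mathcal{F}_X$ for every $f\in\mathcal{F}_Y$. Functors (all send maps to themselves). For a diffeology $\mathcal{D}$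 on $X$ put $\Lambda\mathcal{D}=\{c:\mathbb{R}\to X\mid c\in\mathcal{D}\}$ and, for $(X,\mathcal{D})$ reflexive, $\mathbf{\Lambda}(X,\mathcal{D})=(X,\Lambda\mathcal{D},\Phi\Lambda\mathcal{D})$. $\mathbf{\Xi}(X,\mathcal{C},\mathcal{F})=(X,\mathcal{F})$ is the forgetful functor from Frölicher spaces to reflexive differential spaces. $\mathbf{\Pi}(X,\mathcal{F})=(X,\Pi\mathcal{F})$ is the functor from reflexive differential spaces to reflexive diffeological spaces. *)

(* Defs.v *)
From HB Require Import structures.
From mathcomp Require Import all_boot all_order all_algebra.
From mathcomp Require Import all_classical all_reals all_analysis.

Set Implicit Arguments.
Unset Strict Implicit.
Unset Printing Implicit Defensive.

Import Order.TTheory GRing.Theory Num.Theory.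
Import numFieldNormedType.Exports.

Local Open Scope classical_set_scope.
Local Open Scope ring_scope.

Section Smoothness.
Context {R : realType}.

(* U is meant to be open: continuity and the partial derivatives at points of U
   are those of the total function f, hence depend only on the values of f on U. *)
Fixpoint Ck (k : nat) (n : nat) (U : set 'rV[R]_n) (f : 'rV[R]_n -> R) : Prop :=
  (forall x, U x -> {for x, continuous f}) /\
  if k is k'.+1 then
    forall i : 'I_n, (forall x, U x -> derivable f x 'e_i) /\
      Ck k' U (fun x => 'D_('e_i) f x)
  else True.

(* The extension of g by zero outside the open set U only serves to apply the
   library's derivative; the choice of values outside U is irrelevant. *)
Definition smooth_on (n : nat) (U : set 'rV[R]_n) (g : U -> R) : Prop :=
  forall k, Ck k U ('valL_(0 : R) g).

Definition smooth (n : nat) (F : 'rV[R]_n -> R) : Prop :=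
  forall k, Ck k setT F.

Definition smooth_map (m n : nat) (V : set 'rV[R]_m) (U : set 'rV[R]_n)
    (F : V -> U) : Prop :=
  forall j : 'I_n, smooth_on (fun v : V => (val (F v)) 0 j).

Lemma valL_in n (U : set 'rV[R]_n) (g : U -> R) (u : U) :
  'valL_(0 : R) g (val u) = g u.
Proof. by rewrite /valL_ /= oinv_set_val valK. Qed.

Lemma Ck_cont k n (U : set 'rV[R]_n) f :
  Ck k U f -> forall x, U x -> {for x, continuous f}.
Proof. by case: k => [|k] []. Qed.

Lemma Ck_pred k n (U : set 'rV[R]_n) f : Ck k.+1 U f -> Ck k U f.
Proof.
elim: k f => [|k IH] f; first by case.
move=> [cf df]; split=> // i; have [dfi /IH] := df i; by split.
Qed.

Lemma Ck_sub k n (U V : set 'rV[R]_n) f : V `<=` U -> Ck k U f -> Ck k V f.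
Proof.
move=> VU; elim: k f => [|k IH] f [cf df]; split => //.
- by move=> x /VU; exact: cf.
- by move=> x /VU; exact: cf.
- by move=> i; have [dfi /IH] := df i; split => // x /VU; exact: dfi.
Qed.

Lemma Ck_eq k n (U : set 'rV[R]_n) f g : open U ->
  (forall x, U x -> f x = g x) -> Ck k U f -> Ck k U g.
Proof.
move=> oU.
have nb (h1 h2 : 'rV[R]_n -> R) x : (forall x, U x -> h1 x = h2 x) -> U x ->
    {near x, h1 =1 h2}.
  by move=> fg Ux; apply: filterS (open_nbhs_nbhs (conj oU Ux)) => y /fg.
have cc (h1 h2 : 'rV[R]_n -> R) : (forall x, U x -> h1 x = h2 x) ->
    (forall x, U x -> {for x, continuous h1}) ->
    forall x, U x -> {for x, continuous h2}.
  move=> fg cf x Ux; have := cf x Ux.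
  rewrite /prop_for /continuous_at -(fg _ Ux).
  exact: cvg_trans (near_eq_cvg (nb _ _ _ fg Ux)).
elim: k f g => [|k IH] f g fg [cf df]; split => //; try exact: (cc f).
move=> i; have [dfi Cfi] := df i; split.
  by move=> x Ux; apply: near_eq_derivable (dfi x Ux); exact: nb.
by apply: IH Cfi => x Ux; apply: near_eq_derive; exact: nb.
Qed.

Lemma Ck_local k n (U : set 'rV[R]_n) f :
  (forall x, U x -> exists V, V x /\ Ck k V f) -> Ck k U f.
Proof.
elim: k f => [|k IH] f H; split => //.
- by move=> x /H[V [Vx [cf _]]]; exact: cf.
- by move=> x /H[V [Vx [cf _]]]; exact: cf.
- move=> i; split.
    by move=> x /H[V [Vx [_ /(_ i)[df _]]]]; exact: df.
  by apply: IH => x /H[V [Vx [_ /(_ i)[_ df]]]]; exists V.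
Qed.

Lemma Ck_cst k n (U : set 'rV[R]_n) c : Ck k U (fun=> c).
Proof.
elim: k c => [|k IH] c; split => //; try by move=> x _; exact: cst_continuous.
move=> i; split; first by move=> x _; exact: derivable_cst.
have -> : (fun x : 'rV[R]_n => 'D_('e_i) (fun=> c) x) = fun=> 0.
  by apply/funext => x; exact: derive_cst.
exact: IH.
Qed.

Lemma Ck_add k n (U : set 'rV[R]_n) f g : open U ->
  Ck k U f -> Ck k U g -> Ck k U (fun x => f x + g x).
Proof.
move=> oU; elim: k f g => [|k IH] f g [cf df] [cg dg]; split => //;
  try by move=> x Ux; exact: continuousD (cf x Ux) (cg x Ux).
move=> i; have [dfi Cfi] := df i; have [dgi Cgi] := dg i; split.
  by move=> x Ux; apply: derivableD; [exact: dfi|exact: dgi].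
apply: (Ck_eq oU _ (IH _ _ Cfi Cgi)) => x Ux.
by rewrite deriveD//; [exact: dfi|exact: dgi].
Qed.

Lemma Ck_mul k n (U : set 'rV[R]_n) f g : open U ->
  Ck k U f -> Ck k U g -> Ck k U (fun x => f x * g x).
Proof.
move=> oU; elim: k f g => [|k IH] f g Cf Cg; have [cf df] := Cf;
  have [cg dg] := Cg; split => //;
  try by move=> x Ux; exact: continuousM (cf x Ux) (cg x Ux).
move=> i; have [dfi Cfi] := df i; have [dgi Cgi] := dg i; split.
  by move=> x Ux; apply: derivableM; [exact: dfi|exact: dgi].
apply: (Ck_eq oU _ (Ck_add oU (IH _ _ (Ck_pred Cf) Cgi)
                              (IH _ _ (Ck_pred Cg) Cfi))) => x Ux.
by rewrite deriveM//; [exact: dfi|exact: dgi].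
Qed.

Lemma Ck_sum k n (U : set 'rV[R]_n) m (f : 'I_m -> 'rV[R]_n -> R) : open U ->
  (forall j, Ck k U (f j)) -> Ck k U (fun x => \sum_j f j x).
Proof.
move=> oU; elim: m f => [|m IH] f Cf.
  under eq_fun do rewrite big_ord0.
  exact: Ck_cst.
under eq_fun do rewrite big_ord_recl.
by apply: Ck_add => //; exact: IH.
Qed.

Lemma MVT_coord n (f : 'rV[R]_n -> R) (z : 'rV[R]_n) (j : 'I_n) (d : R) :
  (forall t, `|t| <= `|d| -> derivable f (z + t *: 'e_j) 'e_j) ->
  exists2 t, `|t| <= `|d| &
    f (z + d *: 'e_j) - f z
      = 'D_('e_j) f (z + t *: 'e_j) * d.
Proof.
set e := 'e_j => df.
pose phi (t : R) := f (z + t *: e).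
have dphi (t : R) : `|t| <= `|d| -> is_derive t 1 phi ('D_e f (z + t *: e)).
  move=> /df dft.
  have E : (fun h : R => h^-1 *: ((phi \o shift t) (h *: 1) - phi t)) =
      (fun h => h^-1 *: ((f \o shift (z + t *: e)) (h *: e) - f (z + t *: e))).
    apply/funext => h; rewrite /phi /= [h *: 1]mulr1 scalerDl addrCA.
    by [].
  by split; rewrite /derivable /derive E.
have cphi (a b : R) : (forall t : R, a <= t <= b -> `|t| <= `|d|) ->
    {within `[a, b], continuous phi}.
  move=> H; apply: derivable_within_continuous => t /itvP tab.
  by have [] := dphi t (H t _) => //; rewrite !tab.
have phi0 : phi 0 = f z by rewrite /phi scale0r addr0.
have [d0|d0] := leP 0 d.
- have dH (t : R) : 0 <= t <= d -> `|t| <= `|d|.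
    by case/andP => t0 td; rewrite !ger0_norm// (le_trans t0).
  have dI : forall t, t \in `]0, d[ -> is_derive t 1 phi ('D_e f (z + t *: e)).
    by move=> t /itvP H; apply: dphi; apply: dH; rewrite !H.
  have [t td E] := MVT_segment d0 dI (cphi _ _ dH).
  exists t; first by apply: dH; rewrite !(itvP td).
  by rewrite -phi0 -/(phi d) E subr0.
- have dH (t : R) : d <= t <= 0 -> `|t| <= `|d|.
    by case/andP => t0 td; rewrite !ler0_norm ?(ltW d0)// lerN2.
  have dI : forall t, t \in `]d, 0[ -> is_derive t 1 phi ('D_e f (z + t *: e)).
    by move=> t /itvP H; apply: dphi; apply: dH; rewrite !H.
  have [t td E] := MVT_segment (ltW d0) dI (cphi _ _ dH).
  exists t; first by apply: dH; rewrite !(itvP td).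
  by rewrite -phi0 -/(phi d) -opprB E sub0r mulrN opprK.
Qed.

(* Caratheodory's form of the differentiability of a C^1 function. *)
Lemma C1_caratheodory n (W : set 'rV[R]_n) f (y0 : 'rV[R]_n) :
  open W -> W y0 -> Ck 1 W f ->
  exists a : 'I_n -> 'rV[R]_n -> R,
    [/\ forall j, {for y0, continuous (a j)},
        forall j, a j y0 = 'D_('e_j) f y0 &
        forall y, f y - f y0 = \sum_j a j y * (y 0 j - y0 0 j)].
Proof.
move=> oW Wy0 [_ df].
pose z (y : 'rV[R]_n) (k : nat) : 'rV[R]_n :=
  \row_j (if (j < k)%N then y 0 j else y0 0 j).
have zS y (j : 'I_n) : z y j.+1 = z y j + (y 0 j - y0 0 j) *: 'e_j.
  apply/rowP => i; rewrite !mxE eqxx /= ltnS leq_eqVlt.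
  have [/val_inj ->|ij] := eqVneq (i : nat) j.
    by rewrite ltnn eqxx mulr1 /= addrC subrK.
  rewrite (_ : (i == j) = false) ?mulr0 ?addr0//.
  by apply/negbTE; apply: contra_neq ij => ->.
pose a (j : 'I_n) (y : 'rV[R]_n) := if y 0 j == y0 0 j then 'D_('e_j) f y0
  else (f (z y j.+1) - f (z y j)) / (y 0 j - y0 0 j).
exists a; split.
- have a0 j : a j y0 = 'D_('e_j) f y0 by rewrite /a eqxx.
  have FF : Filter (nbhs y0) := nbhs_filter y0.
  move=> j; apply/(@cvgrPdist_lt _ _ _ (nbhs y0) FF) => e e0.
  have [dfj [cdf _]] := df j.
  have : \forall y \near y0, W y /\
      `|'D_('e_j) f y0 - 'D_('e_j) f y| < e.
    near=> y; split.
      by near: y; exact: open_nbhs_nbhs.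
    by near: y; move: (cdf y0 Wy0) => /(@cvgrPdist_lt _ _ _ (nbhs y0) FF); exact.
  move/nbhs_ballP => [r /= r0 rH].
  apply/nbhs_ballP; exists r => //= y [_ yb].
  rewrite a0 /a; case: ifPn => [_|ne]; first by rewrite subrr normr0.
  have zb (t : R) : `|t| <= `|y 0 j - y0 0 j| ->
      ball y0 r (z y j + t *: 'e_j).
    move=> tj; split => // i k; rewrite ord1 !mxE eqxx /=.
    have [->|kj] := eqVneq k j.
      rewrite ltnn mulr1 /ball /= opprD addrA subrr sub0r normrN.
      by apply: le_lt_trans tj _; rewrite distrC; exact: yb.
    rewrite mulr0 addr0; case: ifP => _; first exact: yb.
    exact: ballxx.
  have dz t : `|t| <= `|y 0 j - y0 0 j| ->
      derivable f (z y j + t *: 'e_j) 'e_j.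
    by move=> /zb /rH[+ _]; exact: dfj.
  have [t td E] := MVT_coord dz.
  rewrite zS E mulfK; last by rewrite subr_eq0.
  by have [] := rH _ (zb _ td).
- by move=> j; rewrite /a eqxx.
- move=> y.
  have z0 : z y 0 = y0 by apply/rowP => i; rewrite !mxE.
  have zn : z y n = y by apply/rowP => i; rewrite !mxE ltn_ord.
  rewrite -{1}zn -{1}z0 -(telescope_sumr (fun k => f (z y k)))// big_mkord.
  apply: eq_bigr => j _; rewrite /a; case: eqVneq => [E|ne].
    by rewrite zS E subrr scale0r addr0 subrr mulr0.
  by rewrite divfK// subr_eq0.
Unshelve. all: by end_near. Qed.

Lemma cvg_sum_ord (T : Type) (F : set_system T) (FF : Filter F) n
    (f : 'I_n -> T -> R) (l : 'I_n -> R) :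
  (forall j, f j x @[x --> F] --> l j) ->
  \sum_j f j x @[x --> F] --> \sum_j l j.
Proof.
elim: n f l => [|n IH] f l H.
  under eq_fun do rewrite big_ord0.
  by rewrite big_ord0; exact: cvg_cst.
under eq_fun do rewrite big_ord_recl.
by rewrite big_ord_recl; apply: cvgD => //; exact: IH.
Qed.

Lemma cont_row m n (h : 'I_n -> 'rV[R]_m -> R) x :
  (forall j, {for x, continuous (h j)}) ->
  {for x, continuous (fun x => \row_j h j x)}.
Proof.
move=> ch; have FF : Filter (nbhs x) := nbhs_filter x.
apply/(@cvg_ballP _ _ _ (nbhs x) FF) => e e0.
have : nbhs x [set t | forall j, ball (h j x) e (h j t)].
  apply: (@filter_forall _ _ _ (nbhs x) FF) => j.
  by move: (ch j) => /(@cvg_ballP _ _ _ (nbhs x) FF); exact.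
by apply: filterS => t H; split => // i j; rewrite !mxE.
Qed.

Lemma is_derive_comp m n (W : set 'rV[R]_n) f (h : 'I_n -> 'rV[R]_m -> R) x v :
  open W -> Ck 1 W f -> W (\row_j h j x) ->
  (forall j, {for x, continuous (h j)}) ->
  (forall j, derivable (h j) x v) ->
  is_derive x v (fun x => f (\row_j h j x))
    (\sum_j 'D_('e_j) f (\row_j h j x) * 'D_v (h j) x).
Proof.
move=> oW Cf Wx ch dh.
have [a [ca a0 aE]] := C1_caratheodory oW Wx Cf.
set hx := \row_j h j x in Wx ca a0 aE *.
set L := \sum_j _.
have sh : shift x (t *: v) @[t --> 0^'] --> x.
  apply: cvg_within_filter.
  have : shift x (t *: v) @[t --> (0:R)] --> shift x (0 *: v).
    apply: cvgD; last exact: cvg_cst.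
    by apply: cvgZr_tmp; exact: cvg_id.
  by rewrite /= scale0r add0r.
suff H : (fun t => t^-1 *: (((fun x => f (\row_j h j x)) \o shift x) (t *: v)
    - f hx)) @ 0^' --> L.
  by split; [apply/cvg_ex; exists L|exact/cvg_lim].
have E : (fun t => t^-1 *: (((fun x => f (\row_j h j x)) \o shift x) (t *: v)
    - f hx)) = fun t => \sum_j a j (\row_j h j (shift x (t *: v))) *
       (t^-1 *: ((h j \o shift x) (t *: v) - h j x)).
  apply/funext => t; rewrite /= aE scaler_sumr; apply: eq_bigr => j _.
  by rewrite !mxE -[LHS]/(_ * (_ * _)) -[in RHS]/(_ * (_ * _)) mulrCA.
rewrite E; apply: cvg_sum_ord => j; apply: cvgM; last exact: dh.
rewrite -a0.
apply: (@cvg_comp _ _ _ (fun t => \row_j h j (shift x (t *: v))) (a j) _ (nbhs hx));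
  last exact: ca.
apply: (@cvg_comp _ _ _ (fun t => shift x (t *: v)) (fun y => \row_j h j y) _ (nbhs x)) => //.
exact: cont_row.
Qed.

Lemma Ck_comp k m n (U : set 'rV[R]_m) (W : set 'rV[R]_n) f
    (h : 'I_n -> 'rV[R]_m -> R) : open U -> open W ->
  (forall x, U x -> W (\row_j h j x)) ->
  (forall j, Ck k U (h j)) -> Ck k W f -> Ck k U (fun x => f (\row_j h j x)).
Proof.
move=> oU oW UW; elim: k f => [|k IH] f Ch Cf; split => //.
- move=> x Ux; apply: continuous_comp.
    by apply: cont_row => j; apply: Ck_cont Ux; exact: Ch.
  by apply: (Ck_cont Cf); exact: UW.
- move=> x Ux; apply: continuous_comp.
    by apply: cont_row => j; apply: Ck_cont Ux; exact: Ch.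
  by apply: (Ck_cont Cf); exact: UW.
- have [cf df] := Cf.
  have C1 : Ck 1 W f.
    by split=> // j; have [dfj /Ck_cont Cfj] := df j; split.
  move=> i.
  have D x : U x -> is_derive x 'e_i (fun x => f (\row_j h j x))
    (\sum_j 'D_('e_j) f (\row_j h j x) * 'D_('e_i) (h j) x).
    move=> Ux; apply: (is_derive_comp oW C1 (UW _ Ux)) => j.
      by apply: Ck_cont Ux; exact: Ch.
    by have [_ /(_ i)[+ _]] := Ch j; exact.
  split; first by move=> x /D[].
  apply: (@Ck_eq k m U (fun x => \sum_j 'D_('e_j) f (\row_j h j x) *
    'D_('e_i) (h j) x)) => //; first by move=> x /D[].
  apply: Ck_sum => // j; apply: Ck_mul => //.
    by apply: (IH ('D_('e_j) f)) => [l|]; [exact: Ck_pred|have [] := df j].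
  by have [_ /(_ i)[]] := Ch j.
Qed.

Lemma smooth_on_cst n (U : set 'rV[R]_n) c : open U -> smooth_on (fun _ : U => c).
Proof.
move=> oU k; apply: (Ck_eq oU _ (Ck_cst k U c)) => x /mem_set Ux.
by rewrite -[x]/(val (exist _ x Ux : U)) valL_in.
Qed.

Lemma smooth_on_local n (U : set 'rV[R]_n) (g : U -> R) :
  (forall u : U, exists (V : set 'rV[R]_n) (VU : V `<=` U),
     [/\ open V, V (val u) & smooth_on (g \o subfun VU)]) ->
  smooth_on g.
Proof.
move=> H k; apply: Ck_local => x /mem_set Ux.
have [V [VU [oV Vx sV]]] := H (exist _ x Ux); exists V; split=> //.
apply: (Ck_eq oV _ (sV k)) => y /mem_set Vy.
rewrite -[y]/(val (exist _ y Vy : V)) valL_in.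
exact: esym (valL_in g (subfun VU (exist _ y Vy))).
Qed.

Lemma smooth_on_restr n (U V : set 'rV[R]_n) (VU : V `<=` U) (g : U -> R) :
  open V -> smooth_on g -> smooth_on (g \o subfun VU).
Proof.
move=> oV sg k; apply: (Ck_eq oV _ (Ck_sub VU (sg k))) => y /mem_set Vy.
rewrite -[y]/(val (exist _ y Vy : V)) valL_in.
exact: (valL_in g (subfun VU (exist _ y Vy))).
Qed.

Lemma smooth_on_comp m n (V : set 'rV[R]_m) (U : set 'rV[R]_n) (F : V -> U)
    (g : U -> R) :
  open V -> open U -> smooth_map F -> smooth_on g -> smooth_on (g \o F).
Proof.
move=> oV oU sF sg k.
pose h (j : 'I_n) := 'valL_(0 : R) (fun v : V => (val (F v)) 0 j).
have hE (v : V) : \row_j h j (val v) = val (F v).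
  by apply/rowP => j; rewrite mxE /h valL_in.
have hU x : V x -> U (\row_j h j x).
  move=> /mem_set Vx; rewrite -[x]/(val (exist _ x Vx : V)) hE.
  exact: set_valP.
apply: (Ck_eq oV _ (@Ck_comp k m n V U _ h oV oU hU (fun j => sF j k) (sg k))).
move=> x /mem_set Vx; rewrite -[x]/(val (exist _ x Vx : V)) hE !valL_in.
by [].
Qed.

Lemma smooth_on_rowcomp m n (V : set 'rV[R]_m) (f : 'I_n -> V -> R)
    (F : 'rV[R]_n -> R) :
  open V -> (forall j, smooth_on (f j)) -> smooth F ->
  smooth_on (fun v => F (\row_j f j v)).
Proof.
move=> oV sf sF k; pose h (j : 'I_n) := 'valL_(0 : R) (f j).
apply: (Ck_eq oV _ (@Ck_comp k m n V setT F h oV openT (fun _ _ => I)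
  (fun j => sf j k) (sF k))).
move=> x /mem_set Vx; rewrite -[x]/(val (exist _ x Vx : V)) valL_in; congr F.
by apply/rowP => j; rewrite !mxE /h valL_in.
Qed.

Lemma smooth_on_continuous n (U : set 'rV[R]_n) (g : U -> R) :
  smooth_on g -> forall x, U x -> {for x, continuous ('valL_(0 : R) g)}.
Proof. by move=> /(_ 0) /Ck_cont. Qed.

End Smoothness.

Section Structures.
Variable R : realType.

Record param (X : Type) := Param {
  pdim : nat;
  pdom : set 'rV[R]_pdim;
  pdom_open : open pdom;
  pfun :> pdom -> X }.

Arguments pdim {X} p.
Arguments pdom {X} p _.
Arguments pdom_open {X} p.

Section OnSet.
Variable X : Type.

Definition const_param (n : nat) (x : X) : param X :=
  Param openT (fun _ : [set: 'rV[R]_n] => x).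

(* R is identified with 'rV[R]_1, here and in Gamma. *)
Definition curve (c : R -> X) : param X :=
  Param openT (fun t : [set: 'rV[R]_1] => c ((val t) 0 0)).

Definition Phi (D0 : set (param X)) : set (X -> R) :=
  [set f : X -> R | forall p, D0 p -> smooth_on (f \o p)].

Definition PhiC (C0 : set (R -> X)) : set (X -> R) := Phi (curve @` C0).

Definition Pi (F0 : set (X -> R)) : set (param X) :=
  [set p : param X | forall f, F0 f -> smooth_on (f \o p)].

Definition Gamma (F0 : set (X -> R)) : set (R -> X) :=
  [set c : R -> X | forall f, F0 f -> smooth_on (f \o curve c)].

Definition curves_of (D : set (param X)) : set (R -> X) :=
  [set c : R -> X | D (curve c)].

Definition is_diffeology (D : set (param X)) : Prop :=
  [/\ forall (x : X) (n : nat), D (const_param n x),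
      forall p : param X,
        (forall u : pdom p,
           exists (V : set 'rV[R]_(pdim p)) (oV : open V) (VU : V `<=` pdom p),
             V (val u) /\ D (Param oV (p \o subfun VU))) ->
        D p
    & forall p : param X, D p ->
        forall (m : nat) (V : set 'rV[R]_m) (oV : open V) (F : V -> pdom p),
          smooth_map F -> D (Param oV (p \o F))].

Definition is_topology (T : set (set X)) : Prop :=
  [/\ T setT,
      forall A B, T A -> T B -> T (A `&` B)
    & forall S : set (set X), S `<=` T -> T (\bigcup_(A in S) A)].

(* The open sets of the weakest topology making every f in F continuous. *)
Definition initial_open (F : set (X -> R)) : set (set X) :=
  smallest is_topology [set A |
    exists2 f, F f & exists2 O, open O & A = f @^-1` O].

Definition is_differential_structure (F : set (X -> R)) : Prop :=
  [/\ F !=set0,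
      forall (k : nat) (f : 'I_k -> X -> R) (G : 'rV[R]_k -> R),
        (forall i, F (f i)) -> smooth G -> F (fun x => G (\row_i f i x))
    & forall f : X -> R,
        (forall x, exists U g,
           [/\ initial_open F U, U x, F g & forall y, U y -> f y = g y]) ->
        F f].

Lemma PiPhiPi (F : set (X -> R)) : Pi (Phi (Pi F)) = Pi F.
Proof.
apply/seteqP; split=> [p Hp f Ff|p Hp f]; last exact.
by apply: Hp => q; exact.
Qed.

Lemma Pi_diffeology (F : set (X -> R)) : is_diffeology (Pi F).
Proof.
split.
- by move=> x n f _; exact: (smooth_on_cst (f x) openT).
- move=> p H f Ff; apply: smooth_on_local => u.
  have [V [oV [VU [Vu Dp]]]] := H u; exists V, VU; split => //.
  exact: (Dp f Ff).
- move=> p Dp m V oV G sG f Ff.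
  exact: (smooth_on_comp oV (pdom_open p) sG (Dp f Ff)).
Qed.

Lemma initial_open_curve (F : set (X -> R)) (c : R -> X) (U : set X) :
  Gamma F c -> initial_open F U ->
  open [set t : 'rV[R]_1 | U (c (t 0 0))].
Proof.
move=> Fc /(_ [set A | open [set t : 'rV[R]_1 | A (c (t 0 0))]]).
apply; split.
- split.
  + exact: openT.
  + by move=> A B oA oB; exact: openI.
  + move=> S ST /=.
    rewrite (_ : [set t | _] =
      \bigcup_(A in S) [set t : 'rV[R]_1 | A (c (t 0 0))]).
      by apply: bigcup_open => A /ST.
    by apply/seteqP; split.
- move=> _ [f Ff [W oW ->]].
  have cf := smooth_on_continuous (Fc f Ff).
  have {}cf : continuous ('valL_(0 : R) (f \o curve c)) by move=> x; exact: cf.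
  rewrite /= (_ : [set t | _] =
      'valL_(0 : R) (f \o curve c) @^-1` W); last first.
    apply/funext => t; rewrite /preimage /mkset; congr W.
    have Tt : t \in [set: 'rV[R]_1] by rewrite inE.
    exact: esym (valL_in (f \o curve c) (exist _ t Tt)).
  by apply: open_comp => // x _; exact: cf.
Qed.

Lemma PhiC_differential_structure (C : set (R -> X)) :
  Gamma (PhiC C) = C -> is_differential_structure (PhiC C).
Proof.
move=> GC; split.
- by exists (fun=> 0) => _ [c _ <-]; exact: (smooth_on_cst 0 openT).
- move=> k f G Ff sG _ [c Cc <-].
  apply: (@smooth_on_rowcomp _ _ _ _ (fun j => f j \o curve c)) => //.
    exact: openT.
  by move=> j; apply: Ff; exists c.
- move=> f H _ [c Cc <-]; apply: smooth_on_local => u.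
  have [U [g [oU Ux Fg fg]]] := H (curve c u).
  have oV := initial_open_curve (_ : Gamma (PhiC C) c) oU.
  exists [set t : 'rV[R]_1 | U (c (t 0 0))], (fun _ _ => I); split => //.
    by apply: oV; rewrite GC.
  set VU := fun _ _ => I.
  have -> : (f \o curve c) \o subfun VU = (g \o curve c) \o subfun VU.
    by apply/funext => v; apply: fg; exact: (set_valP v).
  apply: smooth_on_restr; first by apply: oV; rewrite GC.
  by apply: Fg; exists c.
Qed.

Lemma PhiC_reflexive (C : set (R -> X)) :
  Gamma (PhiC C) = C -> Phi (Pi (PhiC C)) = PhiC C.
Proof.
move=> GC; apply/seteqP; split=> [f Hf _ [c Cc <-]|f Hf p]; last exact.
apply: Hf => g; rewrite -[in C c]GC in Cc; exact: Cc.
Qed.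

End OnSet.

Record category := Category {
  obj :> Type;
  mor : obj -> obj -> Type;
  idmor : forall a, mor a a;
  compmor : forall a b c, mor b c -> mor a b -> mor a c;
  comp_idl : forall a b (f : mor a b), compmor (idmor b) f = f;
  comp_idr : forall a b (f : mor a b), compmor f (idmor a) = f;
  compA : forall a b c d (f : mor c d) (g : mor b c) (h : mor a b),
    compmor f (compmor g h) = compmor (compmor f g) h }.

Record functor (C D : category) := Functor {
  fobj :> obj C -> obj D;
  fmap : forall a b, mor a b -> mor (fobj a) (fobj b);
  fmap_id : forall a, fmap (idmor a) = idmor (fobj a);
  fmap_comp : forall a b c (f : mor b c) (g : mor a b),
    fmap (compmor f g) = compmor (fmap f) (fmap g) }.

Definition id_functor (C : category) : functor C C :=
  @Functor C C id (fun _ _ f => f) (fun _ => erefl) (fun _ _ _ _ _ => erefl).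

Lemma comp_fmap_id (C D E : category) (G : functor D E) (F : functor C D) a :
  fmap G (fmap F (idmor a)) = idmor (G (F a)).
Proof. by rewrite !fmap_id. Qed.

Lemma comp_fmap_comp (C D E : category) (G : functor D E) (F : functor C D)
    a b c (f : mor b c) (g : mor a b) :
  fmap G (fmap F (compmor f g)) = compmor (fmap G (fmap F f)) (fmap G (fmap F g)).
Proof. by rewrite !fmap_comp. Qed.

Definition comp_functor (C D E : category) (G : functor D E) (F : functor C D) :
    functor C E :=
  @Functor C E (fun a => G (F a)) (fun a b f => fmap G (fmap F f))
    (comp_fmap_id G F) (comp_fmap_comp G F).

Definition inverse_functors (C D : category) (F : functor C D)
    (G : functor D C) : Prop :=
  comp_functor G F = id_functor C /\ comp_functor F G = id_functor D.

Section Concrete.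
Variables (T : Type) (car : T -> Type).
Variable P : forall X Y : T, (car X -> car Y) -> Prop.
Hypothesis P_id : forall X, P (@id (car X)).
Hypothesis P_comp : forall (X Y Z : T) (g : car Y -> car Z) (f : car X -> car Y),
  P g -> P f -> P (g \o f).

Definition chom (X Y : T) : Type := {f : car X -> car Y | P f}.

Lemma chom_eq (X Y : T) (f g : chom X Y) : sval f = sval g -> f = g.
Proof.
case: f g => [f Pf] [g Pg] /= fg; rewrite -fg in Pg *.
by rewrite (Prop_irrelevance Pf Pg).
Qed.

Definition cid (X : T) : chom X X := exist _ id (P_id X).

Definition ccomp (X Y Z : T) (g : chom Y Z) (f : chom X Y) : chom X Z :=
  exist _ (sval g \o sval f) (P_comp (svalP g) (svalP f)).

Lemma ccomp_idl X Y (f : chom X Y) : ccomp (cid Y) f = f.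
Proof. exact: chom_eq. Qed.

Lemma ccomp_idr X Y (f : chom X Y) : ccomp f (cid X) = f.
Proof. exact: chom_eq. Qed.

Lemma ccompA X Y Z W (f : chom Z W) (g : chom Y Z) (h : chom X Y) :
  ccomp f (ccomp g h) = ccomp (ccomp f g) h.
Proof. exact: chom_eq. Qed.

Definition concrete_category : category :=
  Category ccomp_idl ccomp_idr ccompA.

End Concrete.

Record reflexive_diffeological_space := ReflexiveDiffeological {
  rd_car : Type;
  rd_inhabited : inhabited rd_car;
  rd_plots : set (param rd_car);
  rd_diffeology : is_diffeology rd_plots;
  rd_reflexive : Pi (Phi rd_plots) = rd_plots }.

Arguments rd_plots : clear implicits.

Record reflexive_differential_space := ReflexiveDifferential {
  rs_car : Type;
  rs_inhabited : inhabited rs_car;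
  rs_funs : set (rs_car -> R);
  rs_structure : is_differential_structure rs_funs;
  rs_reflexive : Phi (Pi rs_funs) = rs_funs }.

Arguments rs_funs : clear implicits.

Record frolicher_space := Frolicher {
  fr_car : Type;
  fr_inhabited : inhabited fr_car;
  fr_curves : set (R -> fr_car);
  fr_funs : set (fr_car -> R);
  fr_PhiC : PhiC fr_curves = fr_funs;
  fr_Gamma : Gamma fr_funs = fr_curves }.

Arguments fr_curves : clear implicits.
Arguments fr_funs : clear implicits.

Definition diffeologically_smooth (X Y : reflexive_diffeological_space)
    (F : rd_car X -> rd_car Y) : Prop :=
  forall p : param (rd_car X), rd_plots X p ->
    rd_plots Y (Param (pdom_open p) (F \o p)).

Definition functionally_smooth (X Y : reflexive_differential_space)
    (F : rs_car X -> rs_car Y) : Prop :=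
  forall f : rs_car Y -> R, rs_funs Y f -> rs_funs X (f \o F).

Definition frolicher_smooth (X Y : frolicher_space)
    (F : fr_car X -> fr_car Y) : Prop :=
  forall f : fr_car Y -> R, fr_funs Y f -> fr_funs X (f \o F).

Lemma diffeologically_smooth_id X :
  diffeologically_smooth (@id (rd_car X)).
Proof. by move=> [n U oU p]. Qed.

Lemma diffeologically_smooth_comp (X Y Z : reflexive_diffeological_space)
    (G : rd_car Y -> rd_car Z) (F : rd_car X -> rd_car Y) :
  diffeologically_smooth G -> diffeologically_smooth F ->
  diffeologically_smooth (G \o F).
Proof. by move=> sG sF p /sF /sG. Qed.

Lemma functionally_smooth_id X : functionally_smooth (@id (rs_car X)).
Proof. by []. Qed.

Lemma functionally_smooth_comp (X Y Z : reflexive_differential_space)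
    (G : rs_car Y -> rs_car Z) (F : rs_car X -> rs_car Y) :
  functionally_smooth G -> functionally_smooth F ->
  functionally_smooth (G \o F).
Proof. by move=> sG sF f /sG /sF. Qed.

Lemma frolicher_smooth_id X : frolicher_smooth (@id (fr_car X)).
Proof. by []. Qed.

Lemma frolicher_smooth_comp (X Y Z : frolicher_space)
    (G : fr_car Y -> fr_car Z) (F : fr_car X -> fr_car Y) :
  frolicher_smooth G -> frolicher_smooth F -> frolicher_smooth (G \o F).
Proof. by move=> sG sF f /sG /sF. Qed.

Definition ReflDiffeol : category :=
  concrete_category diffeologically_smooth_id diffeologically_smooth_comp.

Definition ReflDiffSp : category :=
  concrete_category functionally_smooth_id functionally_smooth_comp.

Definition Frol : category :=
  concrete_category frolicher_smooth_id frolicher_smooth_comp.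

Lemma Lambda_Gamma (X : reflexive_diffeological_space) :
  Gamma (PhiC (curves_of (rd_plots X))) = curves_of (rd_plots X).
Proof.
apply/seteqP; split=> [c Hc|c Hc f Hf]; last by apply: Hf; exists c.
rewrite /curves_of /= -rd_reflexive => f Hf; apply: Hc => _ [d Dd <-].
exact: Hf.
Qed.

Definition Lambda_obj (X : ReflDiffeol) : Frol :=
  Frolicher (rd_inhabited X) erefl (Lambda_Gamma X).

Lemma Lambda_smooth (X Y : ReflDiffeol) (F : rd_car X -> rd_car Y) :
  diffeologically_smooth F ->
  @frolicher_smooth (Lambda_obj X) (Lambda_obj Y) F.
Proof.
move=> sF f Hf _ [c Hc <-].
by have := Hf (curve (F \o c)); apply; exists (F \o c) => //; exact: (sF _ Hc).
Qed.

Definition Lambda_map (X Y : ReflDiffeol) (F : mor X Y) :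
    mor (Lambda_obj X) (Lambda_obj Y) :=
  exist _ (sval F) (Lambda_smooth (svalP F)).

Lemma Lambda_id (X : ReflDiffeol) : Lambda_map (idmor X) = idmor (Lambda_obj X).
Proof. exact: chom_eq. Qed.

Lemma Lambda_comp (X Y Z : ReflDiffeol) (G : mor Y Z) (F : mor X Y) :
  Lambda_map (compmor G F) = compmor (Lambda_map G) (Lambda_map F).
Proof. exact: chom_eq. Qed.

Definition Lambda : functor ReflDiffeol Frol := Functor Lambda_id Lambda_comp.

Lemma Xi_structure (X : frolicher_space) :
  is_differential_structure (fr_funs X).
Proof.
rewrite -fr_PhiC; apply: PhiC_differential_structure.
by rewrite fr_PhiC fr_Gamma.
Qed.

Lemma Xi_reflexive (X : frolicher_space) :
  Phi (Pi (fr_funs X)) = fr_funs X.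
Proof.
rewrite -fr_PhiC; apply: PhiC_reflexive.
by rewrite fr_PhiC fr_Gamma.
Qed.

Definition Xi_obj (X : Frol) : ReflDiffSp :=
  ReflexiveDifferential (fr_inhabited X) (Xi_structure X) (Xi_reflexive X).

Definition Xi_map (X Y : Frol) (F : mor X Y) : mor (Xi_obj X) (Xi_obj Y) :=
  exist _ (sval F) (svalP F).

Lemma Xi_id (X : Frol) : Xi_map (idmor X) = idmor (Xi_obj X).
Proof. exact: chom_eq. Qed.

Lemma Xi_comp (X Y Z : Frol) (G : mor Y Z) (F : mor X Y) :
  Xi_map (compmor G F) = compmor (Xi_map G) (Xi_map F).
Proof. exact: chom_eq. Qed.

Definition Xi : functor Frol ReflDiffSp := Functor Xi_id Xi_comp.

Definition Pi_obj (X : ReflDiffSp) : ReflDiffeol :=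
  ReflexiveDiffeological (rs_inhabited X) (Pi_diffeology (rs_funs X))
    (PiPhiPi (rs_funs X)).

Lemma Pi_smooth (X Y : ReflDiffSp) (F : rs_car X -> rs_car Y) :
  functionally_smooth F -> @diffeologically_smooth (Pi_obj X) (Pi_obj Y) F.
Proof. by move=> sF p Hp f /sF /Hp. Qed.

Definition Pi_map (X Y : ReflDiffSp) (F : mor X Y) :
    mor (Pi_obj X) (Pi_obj Y) :=
  exist _ (sval F) (Pi_smooth (svalP F)).

Lemma Pi_id (X : ReflDiffSp) : Pi_map (idmor X) = idmor (Pi_obj X).
Proof. exact: chom_eq. Qed.

Lemma Pi_comp (X Y Z : ReflDiffSp) (G : mor Y Z) (F : mor X Y) :
  Pi_map (compmor G F) = compmor (Pi_map G) (Pi_map F).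
Proof. exact: chom_eq. Qed.

Definition Pi_functor : functor ReflDiffSp ReflDiffeol := Functor Pi_id Pi_comp.

End Structures.

(* Main.v *)
Require Import Defs.
From mathcomp Require Import all_boot all_order all_algebra.
From mathcomp Require Import all_classical all_reals all_analysis.
From mathcomp Require Import ring lra.

(** Both functors keep the underlying sets and maps, so the theorem says that
    the structures are recovered: Pi F restricted to curves is Gamma F, which is
    the family of curves of a Froelicher space by definition, and conversely a
    reflexive diffeology D is Pi (Phi (Lambda D)).  Since D = Pi (Phi D), the
    latter amounts to Phi (Lambda D) = Phi D ([PhiC_curves_of]): a function that
    is smooth along every curve of D is smooth along every plot p.  Precomposing
    p with smooth curves of its domain gives curves of D, so this is Boman's
    theorem ([boman]): a function on an open subset U of R^n is smooth as soon
    as its composites with all smooth curves of U are.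

    The proof of Boman's theorem given here uses finite differences.  First, for
    every k, the k-th difference of f with a repeated step w is O(|w|^k),
    uniformly near each point.  Otherwise there are points y_j and steps w_j,
    arbitrarily close to x and to 0, at which this fails with arbitrarily large
    constants C_j.  Tiny segments at y_j in the directions w_j all lie on one
    smooth curve c ([special_curve]), obtained by gluing bumps on disjoint
    intervals that shrink to 0.  Along c the differences of f are those of the
    smooth function f \o c, which by the mean value theorem obey a bound
    ([derivs_diffs_le]) incompatible with large C_j.

    Second, a polarisation identity of Djokovic ([polarization]) writes a
    difference with k different steps as a combination of k-th differences with
    repeated steps, so all mixed differences of order k with steps of size d are
    O(d^k): f is [tame].  Third, a tame function is continuous, has directional
    derivatives, and these are tame again; hence it has continuous partial
    derivatives of all orders ([tame_Ck]). *)

Set Implicit Arguments.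
Unset Strict Implicit.
Unset Printing Implicit Defensive.

Import Order.TTheory GRing.Theory Num.Theory.
Import numFieldNormedType.Exports.

Local Open Scope classical_set_scope.
Local Open Scope ring_scope.

(** * Iterated finite differences *)

Section Differences.
Variables (R : realType) (V : normedModType R).
Implicit Types (f g : V -> R) (v w x y z : V) (vs : seq V).

Lemma dist_shift_le (x' x c : V) (a d : R) :
  `|c| <= d -> `|x' - (x + c)| <= a -> `|x' - x| <= a + d.
Proof.
move=> cd H; have -> : x' - x = x' - (x + c) + c by rewrite opprD addrA subrK.
by apply: le_trans (ler_normD _ _) _; exact: lerD.
Qed.

Definition diff v f : V -> R := fun y => f (y + v) - f y.

Fixpoint diffs vs f : V -> R :=
  if vs is v :: vs' then diffs vs' (diff v f) else f.

Lemma diffs_cons v vs f y :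
  diffs (v :: vs) f y = diffs vs f (y + v) - diffs vs f y.
Proof.
elim: vs f => [|w vs IH] f //.
rewrite -(IH (diff w f)) /=; congr (diffs vs _ y).
apply/funext => z; rewrite /diff (addrAC z v w); ring.
Qed.

Lemma diffsZ c vs f y : diffs vs (fun z => c * f z) y = c * diffs vs f y.
Proof. by elim: vs y => [//|v vs IH] y; rewrite !diffs_cons !IH mulrBr. Qed.

(** The alternating sum, over the subsets T of the steps v_j, v_(j+1), ..., of F at
    (z + sum of the v_i in T, w - sum of the v_i / i in T).  The weights 1 / i
    make the points z + i w independent of whether v_i is chosen, and this is
    the source of the cancellations below. *)
Fixpoint polar vs (j : nat) (F : V -> V -> R) z w : R :=
  if vs is v :: vs' then
    polar vs' j.+1 F z w - polar vs' j.+1 F (z + v) (w - j%:R^-1 *: v)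
  else F z w.

Lemma polarB vs j F G z w :
  polar vs j (fun z w => F z w - G z w) z w = polar vs j F z w - polar vs j G z w.
Proof. by elim: vs j z w => [//|v vs IH] j z w /=; rewrite !IH; ring. Qed.

Lemma polar_line vs j i f z w z' w' : z + i%:R *: w = z' + i%:R *: w' ->
  polar vs j (fun z w => f (z + i%:R *: w)) z w =
  polar vs j (fun z w => f (z + i%:R *: w)) z' w'.
Proof.
elim: vs j z w z' w' => [|v vs IH] j z w z' w' E /=; first by rewrite E.
rewrite (IH _ _ _ _ _ E); congr (_ - _); apply: IH.
by rewrite !scalerBr !addrA !(addrAC _ v) E.
Qed.

(** For a function of z + i w, choosing v_i or not gives the same value, so the
    two halves of the alternating sum at the index i cancel. *)
Lemma polar_line0 vs j i f z w : (0 < j)%N -> (j <= i < j + size vs)%N ->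
  polar vs j (fun z w => f (z + i%:R *: w)) z w = 0.
Proof.
elim: vs j z w => [|v vs IH] j z w j0 /=.
  by rewrite addn0 ltnNge => /andP[->].
rewrite addnS -addSn leq_eqVlt => /andP[/orP[/eqP ji _|ji jn]].
  apply/eqP; rewrite subr_eq0; apply/eqP; apply: polar_line.
  rewrite ji scalerBr scalerA mulfV ?scale1r ?pnatr_eq0 -?lt0n -?ji//.
  by rewrite addrACA subrr addr0.
by rewrite !IH ?subrr// ji.
Qed.

Lemma diffs_nseqS n w f y :
  diffs (nseq n.+1 w) f y = diffs (nseq n w) f (y + w) - diffs (nseq n w) f y.
Proof. exact: diffs_cons. Qed.

(** The difference of order n at z + i w involves the points z + l w with
    i <= l <= i + n only, each of which contributes 0. *)
Lemma polar_diag0 vs n i f z w : (0 < i)%N -> (i + n <= size vs)%N ->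
  polar vs 1 (fun z w => diffs (nseq n w) f (z + i%:R *: w)) z w = 0.
Proof.
elim: n i z w => [|n IH] i z w i0 ni.
  by rewrite polar_line0// i0 add1n ltnS -(addn0 i).
rewrite (_ : (fun z w => _) = fun z w => diffs (nseq n w) f (z + i.+1%:R *: w) -
  diffs (nseq n w) f (z + i%:R *: w)).
  by rewrite polarB !IH ?subrr// ?addSnnS// (leq_trans _ ni)// leq_add2l.
apply/funext => z'; apply/funext => w'.
by rewrite diffs_nseqS -natr1 scalerDl scale1r addrA.
Qed.

Lemma polar_cst vs j f z w :
  polar vs j (fun z _ => f z) z w = (-1) ^+ size vs * diffs vs f z.
Proof.
elim: vs j z w => [|v vs IH] j z w; first by rewrite /= mul1r.
by rewrite diffs_cons /= !IH exprS; ring.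
Qed.

(** Djokovic's polarisation identity.  Each step of the recursion
    D_w^(n+1) f (z) = D_w^n f (z + w) - D_w^n f (z) loses its first term by
    [polar_diag0], so that only the value of f at z survives, up to a sign; its
    alternating sum is the mixed difference. *)
Lemma polarization vs f z w :
  diffs vs f z = polar vs 1 (fun z w => diffs (nseq (size vs) w) f z) z w.
Proof.
have H n : (n <= size vs)%N -> polar vs 1 (fun z w => diffs (nseq n w) f z) z w
    = (-1) ^+ n * polar vs 1 (fun z _ => f z) z w.
  elim: n => [|n IH] ns; first by rewrite mul1r.
  rewrite (_ : (fun z w => _) = fun z w => diffs (nseq n w) f (z + 1%:R *: w) -
    diffs (nseq n w) f z).
    by rewrite polarB polar_diag0// IH 1?ltnW// exprS; ring.
  by apply/funext => z'; apply/funext => w'; rewrite diffs_nseqS scale1r.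
by rewrite H// polar_cst mulrA -exprD -signr_odd oddD addbb mul1r.
Qed.

Lemma polar_le vs j F z w (d M : R) : (0 < j)%N ->
  (forall v, v \in vs -> `|v| <= d) ->
  (forall z' w', `|z' - z| <= (size vs)%:R * d ->
     `|w' - w| <= (size vs)%:R * d -> `|F z' w'| <= M) ->
  `|polar vs j F z w| <= 2 ^+ size vs * M.
Proof.
elim: vs j z w => [|v vs IH] j z w j0 vd FM /=.
  by rewrite mul1r; apply: FM; rewrite subrr normr0 mul0r.
have vs0 : `|v| <= d by apply: vd; rewrite mem_head.
have d0 : 0 <= d := le_trans (normr_ge0 _) vs0.
have vd' u : u \in vs -> `|u| <= d by move=> us; apply: vd; rewrite in_cons us orbT.
have S (u u' : V) (c : V) : `|c| <= d -> `|u' - (u + c)| <= (size vs)%:R * d ->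
    `|u' - u| <= (size vs).+1%:R * d.
  by move=> cd H; rewrite -natr1 mulrDl mul1r; exact: dist_shift_le cd H.
rewrite exprS -mulrA mulrDl !mul1r; apply: le_trans (ler_normB _ _) _.
apply: lerD; apply: IH => // z' w' Hz Hw; apply: FM.
- by apply: (S _ _ 0); rewrite ?normr0 ?addr0.
- by apply: (S _ _ 0); rewrite ?normr0 ?addr0.
- exact: (S _ _ v).
- apply: (S _ _ (- (j%:R^-1 *: v))) => //.
  rewrite normrN normrZ; apply: le_trans vs0; rewrite ler_piMl//.
  rewrite ger0_norm ?invr_ge0// invf_le1 ?ltr0n//.
  by rewrite ler1n.
Qed.

(** Mixed differences are controlled by differences with a repeated step; the
    sum [polar] has 2 ^ (size vs) terms. *)
Lemma diffs_le_diag vs f z (d M : R) :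
  (forall v, v \in vs -> `|v| <= d) ->
  (forall z' w, `|z' - z| <= (size vs)%:R * d -> `|w| <= (size vs)%:R * d ->
     `|diffs (nseq (size vs) w) f z'| <= M) ->
  `|diffs vs f z| <= 2 ^+ size vs * M.
Proof.
move=> vd H; rewrite (polarization _ _ _ 0); apply: (polar_le _ vd) => // z' w' Hz.
by rewrite subr0; exact: H.
Qed.

(** A step N v is a chain of N steps v, so a difference with k such steps is a
    sum of N ^ k differences with the short steps.  This turns a bound in terms
    of the largest step into one proportional to each step. *)
Lemma diffs_subdivide vs f y (d M : R) N :
  (forall v, v \in vs -> `|v| <= d) ->
  (forall y', `|y' - y| <= (size vs)%:R * (N%:R * d) -> `|diffs vs f y'| <= M) ->
  `|diffs [seq N%:R *: v | v <- vs] f y| <= N%:R ^+ size vs * M.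
Proof.
elim: vs f y => [|v vs IH] f y vd H.
  by rewrite mul1r; apply: H; rewrite subrr normr0 mul0r.
have vd0 : `|v| <= d by apply: vd; rewrite mem_head.
have d0 : 0 <= d := le_trans (normr_ge0 _) vd0.
rewrite map_cons diffs_cons.
set g := diffs _ f.
rewrite (_ : g _ - g y =
  \sum_(0 <= i < N) (g (y + i.+1%:R *: v) - g (y + i%:R *: v))); last first.
  rewrite (telescope_sumr (fun i => g (y + i%:R *: v)))//.
  by rewrite scale0r addr0.
apply: le_trans (ler_norm_sum _ _ _) _.
rewrite exprS -mulrA mulr_natl -[X in _ <= _ *+ X]subn0 -sumr_const_nat.
rewrite !big_mkord; apply: ler_sum => i _.
rewrite -natr1 scalerDl scale1r addrA -diffs_cons /=.
apply: IH => [u us|y' Hy']; first by apply: vd; rewrite in_cons us orbT.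
apply: (H y'); rewrite /= -natr1 mulrDl mul1r.
apply: (dist_shift_le (c := i%:R *: v)) => //.
rewrite normrZ normr_nat; apply: ler_pM => //.
by rewrite ler_nat ltnW.
Qed.

Lemma cvg_diffs (T : Type) (F : set_system T) (FF : Filter F) vs
    (h : T -> V -> R) f y (d : R) :
  (forall v, v \in vs -> `|v| <= d) ->
  (forall y', `|y' - y| <= (size vs)%:R * d -> h t y' @[t --> F] --> f y') ->
  diffs vs (h t) y @[t --> F] --> diffs vs f y.
Proof.
elim: vs y => [|v vs IH] y vd H.
  by apply: H; rewrite subrr normr0 mul0r.
have vd0 : `|v| <= d by apply: vd; rewrite mem_head.
have d0 : 0 <= d := le_trans (normr_ge0 _) vd0.
have vd' u : u \in vs -> `|u| <= d by move=> us; apply: vd; rewrite in_cons us orbT.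
under eq_fun do rewrite diffs_cons.
rewrite diffs_cons; apply: cvgB; apply: IH => // y' Hy'; apply: H => /=.
  by rewrite -natr1 mulrDl mul1r; exact: (dist_shift_le (c := v)).
by apply: le_trans Hy' _; rewrite ler_wpM2r// ler_nat.
Qed.

End Differences.

(** * Functions with tame differences are smooth *)

Section Tame.
Variables (R : realType) (V : normedModType R).
Implicit Types (U : set V) (f : V -> R).

(** The bound is in terms of the largest step d only; [diffs_subdivide] makes up
    for this where a single step has to be much smaller than the others. *)
Definition tame U f : Prop := forall x, U x -> forall k,
  exists r C : R, 0 < r /\ forall y (d : R) vs,
    `|y - x| <= r -> 0 < d <= r -> size vs = k ->
    (forall v, v \in vs -> `|v| <= d) -> `|diffs vs f y| <= C * d ^+ k.

Lemma tame_bound U f x k : tame U f -> U x ->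
  exists r C : R, [/\ 0 < r, 0 < C & forall y (d : R) vs,
    `|y - x| <= r -> 0 < d <= r -> size vs = k ->
    (forall v, v \in vs -> `|v| <= d) -> `|diffs vs f y| <= C * d ^+ k].
Proof.
move=> tf Ux; have [r [C [r0 H]]] := tf x Ux k.
exists r, (`|C| + 1); split=> // y d vs yx /andP[d0 dr] vk vd.
have dr' : 0 < d <= r by rewrite d0.
apply: le_trans (H y d vs yx dr' vk vd) _.
apply: ler_wpM2r; first exact: exprn_ge0 (ltW d0).
by rewrite ler_wpDr// ler_norm.
Qed.

Lemma tame_continuous U f x : tame U f -> U x -> {for x, continuous f}.
Proof.
move=> tf Ux; have [r [C [r0 C0 H]]] := tame_bound 1 tf Ux.
apply/cvgrPdist_le => e e0; near=> y.
have [->|yx] := eqVneq y x; first by rewrite subrr normr0 ltW.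
have yx0 : 0 < `|y - x| by rewrite normr_gt0 subr_eq0.
have yd : `|y - x| <= Num.min r (e / C).
  near: y; apply/nbhs_normP; exists (Num.min r (e / C)) => /=.
    by rewrite lt_min r0 divr_gt0.
  by move=> y /= /ltW; rewrite distrC.
move: yd; rewrite le_min => /andP[yr ye].
have := H x `|y - x| [:: y - x]; rewrite subrr normr0 (ltW r0) yx0 yr /=.
rewrite /diff (addrC x) subrK expr1 => /(_ isT isT erefl) Hy.
rewrite distrC; apply: le_trans (Hy _) _; first by move=> v; rewrite inE => /eqP ->.
by rewrite mulrC -ler_pdivlMr.
Unshelve. all: by end_near. Qed.

(** Small second differences make a sequence close to an arithmetic
    progression. *)
Lemma second_differences (a : nat -> R) (M : R) N : 0 <= M ->
  (forall i, (i.+2 <= N)%N -> `|a i.+2 - a i.+1 - (a i.+1 - a i)| <= M) ->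
  `|a N - a 0 - N%:R * (a 1 - a 0)| <= N%:R ^+ 2 * M.
Proof.
move=> M0 H.
have S i : (i.+1 <= N)%N -> `|a i.+1 - a i - (a 1 - a 0)| <= i%:R * M.
  elim: i => [|i IH] iN; first by rewrite subrr normr0 mul0r.
  rewrite -[X in `|X|](subrKA (a i.+1 - a i)) -natr1 mulrDl mul1r addrC.
  by apply: le_trans (ler_normD _ _) (lerD (IH (ltnW iN)) (H i iN)).
have T n : (n <= N)%N -> `|a n - a 0 - n%:R * (a 1 - a 0)| <= n%:R * (N%:R * M).
  elim: n => [|n IH] nN; first by rewrite !mul0r subrr subr0 normr0.
  have -> : a n.+1 - a 0 - n.+1%:R * (a 1 - a 0) =
    (a n - a 0 - n%:R * (a 1 - a 0)) + (a n.+1 - a n - (a 1 - a 0)).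
    by rewrite -natr1; ring.
  apply: le_trans (ler_normD _ _) _; rewrite -natr1 mulrDl mul1r.
  apply: lerD (IH (ltnW nN)) (le_trans (S _ nN) _).
  by rewrite ler_wpM2r// ler_nat ltnW.
by rewrite expr2 -mulrA; exact: T.
Qed.

(** Compare the difference quotients q s and q t for t much smaller than s: with
    N the integral part of s / t, first differences allow to replace s by N t,
    and second differences to replace the increment over N t by N times the one
    over t.  This gives |q s - q t| <= C2 s + 2 C1 t / s, hence a Cauchy filter. *)
Lemma tame_derivable U f x e : tame U f -> U x -> `|e| <= 1 -> derivable f x e.
Proof.
move=> tf Ux e1.
have [r1 [C1 [r10 C10 H1]]] := tame_bound 1 tf Ux.
have [r2 [C2 [r20 C20 H2]]] := tame_bound 2 tf Ux.
pose r := Num.min r1 r2.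
have r0 : 0 < r by rewrite lt_min r10.
have rr1 : r <= r1 by rewrite ge_min lexx.
have rr2 : r <= r2 by rewrite ge_min lexx orbT.
have nZ (a : R) : `|a *: e| <= `|a| by rewrite normrZ ler_piMr.
have xa (a : R) : x + a *: e - x = a *: e by rewrite addrC addKr.
have D1 (a b : R) : `|a| <= r -> 0 < b <= r ->
    `|f (x + (a + b) *: e) - f (x + a *: e)| <= C1 * b.
  move=> ar /andP[b0 br].
  have := H1 (x + a *: e) b [:: b *: e]; rewrite xa b0 (le_trans br rr1).
  rewrite (le_trans (nZ a) (le_trans ar rr1)) /= expr1 => /(_ isT isT erefl).
  rewrite /diff scalerDl addrA; apply => v; rewrite inE => /eqP ->.
  by rewrite (le_trans (nZ b))// gtr0_norm.
have D2 (a b : R) : `|a| <= r -> 0 < b <= r ->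
    `|f (x + (a + b + b) *: e) - f (x + (a + b) *: e) -
      (f (x + (a + b) *: e) - f (x + a *: e))| <= C2 * b ^+ 2.
  move=> ar /andP[b0 br].
  have := H2 (x + a *: e) b [:: b *: e; b *: e].
  rewrite xa b0 (le_trans br rr2).
  rewrite (le_trans (nZ a) (le_trans ar rr2)) /= => /(_ isT isT erefl).
  rewrite /diff !scalerDl !addrA; apply => v.
  by rewrite !inE orbb => /eqP ->; rewrite (le_trans (nZ b))// gtr0_norm.
pose phi (a : R) := f (x + a *: e) - f x.
pose q (a : R) := a^-1 * phi a.
have q2 (s t : R) : 0 < s <= r -> 0 < t <= s ->
    `|q s - q t| <= C2 * s + 2 * C1 * t / s.
  move=> /andP[s0 sr] /andP[t0 ts].
  pose N := Num.truncn (s / t).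
  have /andP[Nl Nu] : N%:R * t <= s < N%:R * t + t.
    have := truncn_itv (ltW (divr_gt0 s0 t0)).
    by rewrite -/N -natr1 ler_pdivlMr// ltr_pdivrMr// mulrDl mul1r.
  have N0 : 0 <= N%:R * t by rewrite mulr_ge0// ltW.
  have Ht : 0 < t <= r by rewrite t0 (le_trans ts).
  have A : `|f (x + s *: e) - f (x + (N%:R * t) *: e)| <= C1 * t.
    have [E|ne] := eqVneq s (N%:R * t).
      by rewrite -E subrr normr0 mulr_ge0 ?(ltW C10) ?(ltW t0).
    have sN0 : 0 < s - N%:R * t by rewrite subr_gt0 lt_neqAle eq_sym ne.
    have sNt : s - N%:R * t <= t by rewrite lerBlDl ltW.
    have := D1 (N%:R * t) (s - N%:R * t).
    rewrite subrKC sN0 (le_trans sNt)//; last by case/andP: Ht.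
    rewrite (ger0_norm N0) (le_trans Nl sr).
    move=> /(_ isT isT) /le_trans; apply; exact: ler_wpM2l (ltW C10) _ _ sNt.
  have B : `|phi (N%:R * t) - N%:R * phi t| <= N%:R ^+ 2 * (C2 * t ^+ 2).
    have := @second_differences (fun i => f (x + (i%:R * t) *: e)) (C2 * t ^+ 2) N.
    rewrite (mulr_ge0 (ltW C20) (exprn_ge0 2 (ltW t0))) mul0r scale0r addr0 mul1r.
    move=> /(_ isT); apply => i iN.
    rewrite -[in i.+2%:R]natr1 -natr1 !mulrDl !mul1r.
    apply: D2 => //; rewrite ger0_norm ?(mulr_ge0 _ (ltW t0))//.
    apply: le_trans (le_trans Nl sr).
    by rewrite ler_wpM2r ?(ltW t0)// ler_nat ltnW// ltnW.
  have D : `|phi t| <= C1 * t.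
    by have := D1 0 t; rewrite normr0 add0r scale0r addr0 (ltW r0); exact.
  have -> : q s - q t =
    ((f (x + s *: e) - f (x + (N%:R * t) *: e)) + (phi (N%:R * t) - N%:R * phi t)
      - phi t * ((s - N%:R * t) / t)) / s.
    by rewrite /q /phi; field; rewrite !gt_eqF.
  have K : `|phi t * ((s - N%:R * t) / t)| <= C1 * t.
    rewrite normrM -[leRHS]mulr1; apply: ler_pM => //.
    rewrite ger0_norm ?divr_ge0 ?subr_ge0 ?(ltW t0)// ler_pdivrMr// mul1r.
    by rewrite lerBlDl ltW.
  have NN : N%:R ^+ 2 * (C2 * t ^+ 2) <= C2 * s ^+ 2.
    rewrite mulrCA -exprMn ler_pM2l//.
    by apply: lerXn2r; rewrite // nnegrE ltW.
  rewrite normrM normfV (gtr0_norm s0) ler_pdivrMr//.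
  apply: le_trans (_ : C1 * t + C2 * s ^+ 2 + C1 * t <= _); last first.
    by rewrite le_eqVlt; apply/orP; left; apply/eqP; field; rewrite gt_eqF.
  apply: le_trans (ler_normB _ _) (lerD _ K).
  by apply: le_trans (ler_normD _ _) (lerD A (le_trans B NN)).
have qN (t : R) : 0 < t <= r -> `|q (- t) - q t| <= C2 * t.
  move=> /andP[t0 tr].
  have := D2 (- t) t; rewrite normrN gtr0_norm// t0 tr => /(_ isT isT).
  rewrite addNr add0r scale0r addr0 => H.
  have -> : q (- t) - q t = - ((f (x + t *: e) - f x - (f x - f (x + - t *: e))) / t).
    by rewrite /q /phi; field; rewrite gt_eqF.
  rewrite normrN normrM normfV (gtr0_norm t0) ler_pdivrMr//.
  by rewrite -mulrA -expr2.
suff : cauchy_ex (q a @[a --> 0^']).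
  move=> /cauchy_exP /cauchy_cvgP; rewrite /derivable.
  by under [in X in X -> _]eq_fun => a do rewrite /q /phi [x + _]addrC.
move=> eps eps0.
pose s := Num.min r (eps / (4 * C2)).
have s0 : 0 < s by rewrite lt_min r0 divr_gt0// mulr_gt0.
have sr : s <= r by rewrite ge_min lexx.
have sE : C2 * s <= eps / 4.
  have : s <= eps / (4 * C2) by rewrite ge_min lexx orbT.
  by rewrite ler_pdivlMr ?mulr_gt0// => ?; lra.
exists (q s).
have tt0 : 0 < Num.min s (s * (eps / (8 * C1))).
  by rewrite lt_min s0 mulr_gt0// divr_gt0// mulr_gt0.
suff : \forall t \near (0 : R)^', ball (q s) eps (q t) by [].
near=> t.
have t0 : t != 0 by near: t; exact: nbhs_dnbhs_neq.
have : `|t| <= Num.min s (s * (eps / (8 * C1))) by near: t; exact: dnbhs0_le.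
rewrite le_min => /andP[ts te].
have tn0 : 0 < `|t| by rewrite normr_gt0.
have A : `|q s - q `|t| | <= C2 * s + 2 * C1 * `|t| / s.
  by apply: q2; rewrite ?s0 ?tn0.
have B : `|q `|t| - q t| <= C2 * s.
  have [tp|tm] := ger0P t; first by rewrite subrr normr0 mulr_ge0 ?ltW.
  rewrite -[in X in _ - X](opprK t) distrC.
  apply: le_trans (qN _ _) _; last by rewrite ler_pM2l// -ltr0_norm.
  by rewrite oppr_gt0 tm -ltr0_norm// (le_trans ts).
have K : 2 * C1 * `|t| / s <= eps / 4.
  rewrite ler_pdivrMr//.
  apply: le_trans (_ : 2 * C1 * (s * (eps / (8 * C1))) <= _).
    by rewrite ler_pM2l// mulr_gt0.
  by rewrite le_eqVlt; apply/orP; left; apply/eqP; field; rewrite gt_eqF.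
rewrite /ball /=.
rewrite -(subrKA (q `|t|)).
apply: le_lt_trans (ler_normD _ _) _.
lra.
Unshelve. all: by end_near. Qed.

(** The derivative is the limit of the quotients by a = d / (N + 1).  Subdividing
    the k other steps into N + 1 pieces makes all k + 1 steps of size at most a,
    so the difference of the quotient is at most
    (N + 1)^k (C a^(k+1)) / a = C d^k, a bound independent of N. *)
Lemma tame_derive U f e : open U -> tame U f -> `|e| <= 1 -> tame U ('D_e f).
Proof.
move=> oU tf e1 x Ux k.
have [r [C [r0 C0 H]]] := tame_bound k.+1 tf Ux.
have [p /= p0 xp] : exists2 p : R, 0 < p & ball x p `<=` U.
  by have /nbhs_ballP := open_nbhs_nbhs (conj oU Ux).
(* The k steps move y by up to k s, and the whole must stay in U. *)
pose s := Num.min r (p / 2) / k.+1%:R.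
have s0 : 0 < s by rewrite divr_gt0// lt_min r0 divr_gt0.
have [sr sp] : k.+1%:R * s <= r /\ k.+1%:R * s <= p / 2.
  by rewrite /s mulrC divfK ?pnatr_eq0// !ge_min !lexx orbT.
exists s, C; split => // y d vs yx /andP[d0 ds] vk vd.
have far y' : `|y' - y| <= k%:R * d -> `|y' - x| <= k.+1%:R * s.
  move=> yy'; rewrite -(subrKA y).
  apply: le_trans (ler_normD _ _) _; rewrite -natr1 mulrDl mul1r.
  by apply: lerD => //; apply: le_trans yy' _; rewrite ler_wpM2l.
have Uy y' : `|y' - y| <= k%:R * d -> U y'.
  move=> /far yx'; apply: xp; rewrite -ball_normE /= distrC.
  by apply: le_lt_trans yx' (le_lt_trans sp _); lra.
have regroup (u w : R) : C * (u * w) ^+ k * w = u ^+ k * (C * w ^+ k.+1).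
  by rewrite exprMn exprS; ring.
pose a (N : nat) : R := d * harmonic N.
have a0 N : 0 < a N by rewrite mulr_gt0 ?harmonic_gt0.
have lim y' : `|y' - y| <= (size vs)%:R * d ->
    (a N)^-1 * diff (a N *: e) f y' @[N --> \oo] --> 'D_e f y'.
  rewrite vk => /Uy Uy'.
  have /cvgr_dnbhsP L : h^-1 * (f (y' + h *: e) - f y') @[h --> 0^'] --> 'D_e f y'.
    under eq_fun => h do rewrite [y' + _]addrC.
    exact: (tame_derivable tf Uy' e1).
  apply: (L a); split; first by move=> N; rewrite gt_eqF.
  rewrite -(mulr0 d); apply: cvgM; [exact: cvg_cst|exact: cvg_harmonic].
have {}lim := @cvg_diffs R V nat \oo eventually_filter vs _ _ y d vd lim.
rewrite -(cvg_lim _ (cvg_norm lim))//.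
apply: limr_le; first by apply: cvgP (cvg_norm lim).
near=> N.
rewrite diffsZ normrM normfV (gtr0_norm (a0 N)) mulrC ler_pdivrMr//.
have aN : N.+1%:R * a N = d by rewrite /a /= mulrCA mulfV ?mulr1 ?pnatr_eq0.
have -> : vs = [seq N.+1%:R *: v | v <- [seq N.+1%:R^-1 *: v | v <- vs]].
  rewrite -map_comp -[LHS]map_id; apply: eq_map => v /=.
  by rewrite scalerA mulfV ?scale1r ?pnatr_eq0.
have -> : C * d ^+ k * a N = N.+1%:R ^+ k * (C * a N ^+ k.+1).
  by rewrite -{1}aN regroup.
have ad : a N <= d.
  by rewrite -aN ler_peMl ?(ltW (a0 N))// ler1n.
rewrite -{1}vk -(size_map (fun v => N.+1%:R^-1 *: v) vs).
have vda v : v \in [seq N.+1%:R^-1 *: v | v <- vs] -> `|v| <= a N.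
  move=> /mapP[w ws ->]; rewrite normrZ normfV normr_nat.
  by rewrite mulrC ler_pdivrMr ?ltr0n// mulrC aN vd.
apply: (diffs_subdivide vda) => y'.
rewrite size_map vk aN => /far yx'.
apply: (H y' (a N) (a N *: e :: _)) => //=.
- exact: le_trans yx' sr.
- rewrite a0 (le_trans ad)// (le_trans ds)// (le_trans _ sr)//.
  by rewrite ler_peMl ?(ltW s0)// ler1n.
- by rewrite size_map vk.
- move=> v; rewrite inE => /orP[/eqP ->|/vda//].
  by rewrite normrZ (gtr0_norm (a0 N)) ler_piMr// (ltW (a0 N)).
Unshelve. all: by end_near. Qed.

End Tame.

Lemma tame_Ck (R : realType) n (U : set 'rV[R]_n) f k :
  open U -> tame U f -> Ck k U f.
Proof.
move=> oU; elim: k f => [|k IH] f tf; split=> //;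
  try by move=> x Ux; exact: tame_continuous tf Ux.
move=> i.
have e1 : `|'e_i : 'rV[R]_n| <= 1.
  rewrite /Num.norm /= mx_normrE; apply: bigmax_le => // -[j l] _ /=.
  by rewrite mxE; case: (_ && _); rewrite ?normr1 ?normr0.
split; first by move=> x Ux; exact: tame_derivable tf Ux e1.
exact/IH/tame_derive.
Qed.

Lemma tame_of_diag (R : realType) (V : normedModType R) (U : set V) (f : V -> R) :
  (forall x, U x -> forall k, exists r C : R, 0 < r /\ forall y w,
     `|y - x| <= r -> `|w| <= r -> `|diffs (nseq k w) f y| <= C * `|w| ^+ k) ->
  tame U f.
Proof.
move=> H x Ux k; have [r [C [r0 {}H]]] := H x Ux k.
(* Polarisation moves base points by up to k d and produces steps up to k d. *)
have k0 : (0 : R) < k.+1%:R by rewrite ltr0n.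
exists (r / k.+1%:R), (2 ^+ k * (`|C| * k%:R ^+ k)); split.
  by rewrite divr_gt0.
move=> y d vs yx /andP[d0 dr] vk vd.
rewrite -!mulrA -exprMn -{1}vk; apply: (diffs_le_diag vd) => z w.
rewrite vk => zy wd.
have kr : k%:R * (r / k.+1%:R) + r / k.+1%:R = r.
  by rewrite -[X in _ + X]mul1r -mulrDl natr1 mulrC divfK// gt_eqF.
have kd : k%:R * d <= k%:R * (r / k.+1%:R) by rewrite ler_wpM2l.
have r1 : 0 < r / k.+1%:R by rewrite divr_gt0.
apply: le_trans (H z w _ _) _.
- rewrite -(subrKA y) -kr; apply: le_trans (ler_normD _ _) _.
  by apply: lerD => //; exact: le_trans zy kd.
- by rewrite -kr; apply: le_trans wd (le_trans kd _); rewrite lerDl ltW.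
- apply: le_trans (_ : `|C| * `|w| ^+ k <= _).
    by rewrite ler_wpM2r ?exprn_ge0// ler_norm.
  rewrite ler_wpM2l//; apply: lerXn2r => //; rewrite nnegrE//.
  by rewrite mulr_ge0// ltW.
Qed.

(** * Smooth functions of one variable *)

Section OneVariable.
Variable R : realType.
Implicit Types (phi psi : R -> R) (D : nat -> R -> R) (F : 'rV[R]_1 -> R).

(** Smoothness of D 0, witnessed by the sequence of its derivatives: to build a
    smooth function it is enough to differentiate every D m once. *)
Definition derivs D : Prop := forall m (t : R), is_derive t 1 (D m) (D m.+1 t).

Definition smooth1 phi : Prop := smooth (fun x : 'rV[R]_1 => phi (x 0 0)).

Lemma rV1E (x : 'rV[R]_1) : x = const_mx (x 0 0).
Proof. by apply/rowP => i; rewrite ord1 mxE. Qed.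

Lemma is_derive_rV1 F (t l : R) :
  is_derive (const_mx t : 'rV[R]_1) 'e_0 F l <->
  is_derive t 1 (fun s : R => F (const_mx s)) l.
Proof.
set G := fun s : R => _.
have E : (fun h : R => h^-1 *: ((G \o shift t) (h *: 1) - G t)) =
    (fun h => h^-1 *: ((F \o shift (const_mx t)) (h *: 'e_0) - F (const_mx t))).
  apply/funext => h; rewrite /G /=; do 2![congr (_ *: _) || congr (_ - _)].
  congr F; apply/rowP => i; rewrite !ord1 !mxE !eqxx.
  by rewrite /GRing.scale /= mulr1.
by split=> [] [dF <-]; split; move: dF; rewrite /derivable /derive E.
Qed.

Lemma derivs_Ck D k m : derivs D -> Ck k setT (fun x : 'rV[R]_1 => D m (x 0 0)).
Proof.
move=> dD.
have cD p (x : 'rV[R]_1) : {for x, continuous (fun x : 'rV[R]_1 => D p (x 0 0))}.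
  apply: continuous_comp; first exact: coord_continuous.
  by apply: differentiable_continuous; apply/derivable1_diffP; have [] := dD p (x 0 0).
have dDx p (x : 'rV[R]_1) :
    is_derive x 'e_0 (fun x : 'rV[R]_1 => D p (x 0 0)) (D p.+1 (x 0 0)).
  rewrite [X in is_derive X]rV1E; apply/is_derive_rV1.
  by under eq_fun => s do rewrite mxE.
elim: k m => [|k IH] m; split; try by move=> x _; exact: cD.
  by [].
move=> i; rewrite (ord1 i); split; first by move=> x _; have [] := dDx m x.
rewrite (_ : (fun x => 'D_'e_0 _ x) = fun x : 'rV[R]_1 => D m.+1 (x 0 0)) //.
by apply/funext => x; have [_ ] := dDx m x.
Qed.

Lemma derivs_smooth1 D m : derivs D -> smooth1 (D m).
Proof. by move=> dD k; exact: derivs_Ck. Qed.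

Lemma smooth_derivs F : smooth F ->
  exists2 D, derivs D & forall t, D 0 t = F (const_mx t).
Proof.
(* Derivatives of F along its only coordinate. *)
move=> sF; pose It m := iter m (fun G : 'rV[R]_1 -> R => 'D_'e_0 G) F.
have sI m : smooth (It m).
  by elim: m => [//|m IH] k; have [_ /(_ 0)[]] := IH k.+1.
exists (fun m t => It m (const_mx t)) => // m t; apply/is_derive_rV1.
by split=> //; have [_ /(_ 0)[+ _]] := sI m 1; exact.
Qed.

Lemma smooth1_derivs phi : smooth1 phi -> exists2 D, derivs D & D 0 = phi.
Proof.
move=> /smooth_derivs[D dD D0]; exists D => //.
by apply/funext => t; rewrite D0 mxE.
Qed.

Lemma smooth1_cst (c : R) : smooth1 (fun=> c).
Proof. by move=> k; exact: Ck_cst. Qed.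

Lemma smooth1_id : smooth1 id.
Proof.
apply: (@derivs_smooth1 (fun m t => if m is m'.+1 then (m' == 0)%:R else t) 0).
by case=> [|m] t; [exact: is_derive_id|exact: is_derive_cst].
Qed.

Lemma smooth1_add phi psi : smooth1 phi -> smooth1 psi ->
  smooth1 (fun t => phi t + psi t).
Proof. by move=> sf sg k; apply: Ck_add => //; exact: openT. Qed.

Lemma smooth1_mul phi psi : smooth1 phi -> smooth1 psi ->
  smooth1 (fun t => phi t * psi t).
Proof. by move=> sf sg k; apply: Ck_mul => //; exact: openT. Qed.

Lemma smooth1_comp phi psi : smooth1 phi -> smooth1 psi -> smooth1 (phi \o psi).
Proof.
move=> sf sg k.
have := @Ck_comp R k 1 1 setT setT (fun x => phi (x 0 0))
  (fun _ x => psi (x 0 0)) openT openT (fun _ _ => I) (fun _ => sg k) (sf k).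
by under [X in Ck _ _ X -> _]eq_fun => x do rewrite mxE.
Qed.

(** * A plateau function *)

Lemma quadratic_is_derive0 phi (C r : R) : 0 < r ->
  (forall t, `|t| < r -> `|phi t| <= C * t ^+ 2) -> is_derive (0 : R) 1 phi 0.
Proof.
move=> r0 H.
have phi0 : phi 0 = 0.
  by apply/eqP; rewrite -normr_le0; have := H 0; rewrite normr0 expr0n /= mulr0; exact.
have L : h^-1 *: ((phi \o shift 0) (h *: (1 : R)) - phi 0) @[h --> 0^'] --> (0 : R).
  apply: (@cvg_to_0_linear R _ C r) => // h /andP[h0 h1].
  rewrite phi0 subr0 /= addr0 /GRing.scale /= mulr1 normrM normfV.
  rewrite mulrC ler_pdivrMr// -mulrA -expr2 real_normK ?num_real//.
  exact: H.
by split; [apply/cvg_ex; exists 0|exact/cvg_lim].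
Qed.

Definition flat (n : nat) (t : R) : R :=
  if 0 < t then t^-1 ^+ n * expR (- t^-1) else 0.

Lemma flat_le n t : `|flat n t| <= n.+2`!%:R * t ^+ 2.
Proof.
rewrite /flat; case: ltP => t0; last by rewrite normr0 mulr_ge0 ?sqr_ge0.
have s0 : 0 < t^-1 by rewrite invr_gt0.
have e0 : t^-1 ^+ n.+2 / (n.+2)`!%:R <= expR t^-1.
  by apply: le_trans (expR_ge1Dxn n.+1 (ltW s0)); rewrite lerDr.
rewrite ger0_norm ?mulr_ge0 ?exprn_ge0 ?expR_ge0 ?(ltW s0)//.
rewrite expRN ler_pdivrMr ?expR_gt0//.
have -> : t^-1 ^+ n = n.+2`!%:R * t ^+ 2 * (t^-1 ^+ n.+2 / n.+2`!%:R).
  rewrite -addn2 exprD; field.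
  by rewrite (gt_eqF t0) pnatr_eq0 -lt0n fact_gt0.
by rewrite ler_pM2l// mulr_gt0 ?exprn_gt0// ltr0n fact_gt0.
Qed.

(** The functions t^(-n) exp(-1/t) are stable under differentiation up to linear
    combinations, and they are flat at 0 by [flat_le]; their smoothness follows
    by induction on the order, for all n at once. *)
Lemma flat_is_derive n (t : R) :
  is_derive t 1 (flat n) (flat n.+2 t - n%:R * flat n.+1 t).
Proof.
have [t0|t0|->] := ltgtP t 0.
- rewrite /flat (lt_gtF t0) mulr0 subr0.
  apply: (@near_eq_is_derive _ _ _ (cst 0)).
  near=> s; rewrite ifF//; apply: lt_gtF; near: s; exact: lt_nbhsl.
- have dV : is_derive t 1 (fun s : R => s^-1) (- t ^- 2).
    have := @is_deriveV R id t 1 1 (lt0r_neq0 t0) (is_derive_id _ _).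
    by rewrite /GRing.scale /= mulr1.
  have dE : is_derive t 1 (fun s : R => expR (- s^-1)) (expR (- t^-1) * t ^- 2).
    have := @is_derive1_comp R expR (fun s => - s^-1) t _ _ (is_derive_expR _)
      (is_deriveN dV).
    by rewrite opprK.
  have dX := is_deriveX n dV.
  have dM := is_deriveM dX dE.
  apply: (@near_eq_is_derive _ _ _
    ((fun s : R => s^-1) ^+ n * (fun s : R => expR (- s^-1)))).
    near=> s; rewrite /flat ifT; first by rewrite /GRing.mul /= exprfctE.
    by near: s; exact: lt_nbhsr.
  apply: is_derive_eq dM _.
  rewrite /flat t0 exprfctE /GRing.scale /= -exprVn.
  by case: n {dX} => [|n] /=; rewrite !exprS; ring.
- rewrite /flat ltxx mulr0 subr0.
  apply: (@quadratic_is_derive0 _ (n.+2)`!%:R 1) => // s _; exact: flat_le.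
Unshelve. all: by end_near. Qed.

Lemma flat_smooth n : smooth1 (flat n).
Proof.
move=> k.
have cf m (x : 'rV[R]_1) : {for x, continuous (fun x : 'rV[R]_1 => flat m (x 0 0))}.
  apply: continuous_comp; first exact: coord_continuous.
  apply: differentiable_continuous; apply/derivable1_diffP.
  by have [] := flat_is_derive m (x 0 0).
have df m (x : 'rV[R]_1) : is_derive x 'e_0 (fun x : 'rV[R]_1 => flat m (x 0 0))
    (flat m.+2 (x 0 0) + - m%:R * flat m.+1 (x 0 0)).
  rewrite [X in is_derive X]rV1E; apply/is_derive_rV1.
  under eq_fun => s do rewrite mxE.
  by rewrite mulNr; exact: flat_is_derive.
elim: k n => [|k IH] n; split; try by move=> x _; exact: cf.
  by [].
move=> i; rewrite (ord1 i); split; first by move=> x _; have [] := df n x.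
rewrite (_ : (fun x => 'D_'e_0 _ x) = fun x : 'rV[R]_1 =>
  flat n.+2 (x 0 0) + - n%:R * flat n.+1 (x 0 0)).
  apply: Ck_add; [exact: openT|exact: IH|].
  by apply: Ck_mul; [exact: openT|exact: Ck_cst|exact: IH].
by apply/funext => x; have [_ ] := df n x.
Qed.

(** With e = flat 0 increasing on t > 0 and zero elsewhere, e (e 1 - e t) is a
    nonzero constant for t <= 0 and vanishes for t >= 1.  Composing it with a
    quadratic polynomial q such that q <= 0 near c and q >= 1 far from c gives
    the plateau, without any quotient of functions. *)
Lemma plateau (c d : R) : 0 < d -> exists psi, [/\ smooth1 psi,
  forall t, `|t - c| <= d / 2 -> psi t = 1 &
  forall t, d <= `|t - c| -> psi t = 0].
Proof.
move=> d0.
have f0 t : t <= 0 -> flat 0 t = 0 by move=> t0; rewrite /flat ltNge t0.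
have fp t : 0 < t -> 0 < flat 0 t by move=> t0; rewrite /flat t0 mul1r expR_gt0.
have fm s t : 0 < s -> s <= t -> flat 0 s <= flat 0 t.
  move=> s0 st; rewrite /flat s0 (lt_le_trans s0 st) !mul1r ler_expR lerN2.
  by rewrite lef_pV2// posrE// (lt_le_trans s0).
pose e1 := flat 0 1; have e10 : 0 < e1 by exact: fp.
pose K t := flat 0 (e1 - flat 0 t) / flat 0 e1.
have sK : smooth1 K.
  apply: smooth1_mul (smooth1_cst _).
  apply: (smooth1_comp (flat_smooth 0)); apply: smooth1_add (smooth1_cst _) _.
  rewrite (_ : (fun t => - flat 0 t) = fun t => -1 * flat 0 t).
    exact: smooth1_mul (smooth1_cst _) (flat_smooth 0).
  by apply/funext => t; rewrite mulN1r.
pose q (t : R) := (t + - c) * (t + - c) * (2 / d ^+ 2) + -1.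
exists (K \o q); split.
- apply: (smooth1_comp sK); apply: smooth1_add (smooth1_cst _).
  apply: smooth1_mul (smooth1_cst _).
  have s := smooth1_add smooth1_id (smooth1_cst (- c)); exact: smooth1_mul.
- move=> t td; rewrite /K /= (f0 (q t)) ?subr0 ?divff ?gt_eqF ?fp//.
  have : (t - c) ^+ 2 <= (d / 2) ^+ 2.
    by rewrite -[_ ^+ 2]real_normK ?num_real// lerXn2r// nnegrE// divr_ge0// ltW.
  rewrite /q -expr2 => H; rewrite subr_le0 mulrA ler_pdivrMr ?exprn_gt0// mul1r.
  apply: le_trans (ler_wpM2r _ H) _ => //.
  by rewrite exprMn; nra.
- move=> t td; rewrite /K /= f0 ?mul0r// subr_le0; apply: fm => //.
  have : d ^+ 2 <= (t - c) ^+ 2.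
    by rewrite -[leRHS]real_normK ?num_real// lerXn2r// nnegrE// ltW.
  rewrite /q -expr2 => H; rewrite lerBrDr mulrA ler_pdivlMr ?exprn_gt0//.
  by rewrite mulrC ler_pM2r//; lra.
Qed.

End OneVariable.

(** * A smooth curve through prescribed segments *)

Section SpecialCurve.
Variable R : realType.
Implicit Types (D : nat -> R -> R).

Lemma derivs_bounded D m (a b : R) : derivs D -> a <= b ->
  exists M, forall t, a <= t <= b -> `|D m t| <= M.
Proof.
move=> dD ab.
have cD : {within `[a, b], continuous (D m)}.
  by apply: derivable_within_continuous => t _; have [] := dD m t.
have [c _ Hc] := EVT_max ab cD; have [d _ Hd] := EVT_min ab cD.
exists (`|D m c| + `|D m d|) => t tab.
have {}tab : t \in `[a, b] by rewrite in_itv.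
have := Hc t tab; have := Hd t tab.
have := ler_norm (D m c); have := ler_norm (- D m d); rewrite normrN.
by move=> *; rewrite ler_norml; apply/andP; split;
  have := normr_ge0 (D m c); have := normr_ge0 (D m d); lra.
Qed.

Lemma derivs_diffs D k m (h t : R) : derivs D ->
  is_derive t 1 (diffs (nseq k h) (D m)) (diffs (nseq k h) (D m.+1) t).
Proof.
move=> dD; elim: k t => [|k IH] t; first exact: dD.
have E p : diffs (nseq k.+1 h) (D p) =
    (diffs (nseq k h) (D p) \o shift h) - diffs (nseq k h) (D p).
  by apply/funext => s; rewrite /= -[LHS]/(diffs (h :: nseq k h) (D p) s) diffs_cons.
have dS := @is_derive1_comp _ _ (shift h) t _ _ (IH (t + h)) (is_derive_shift t 1 h).
by rewrite !E; apply: is_derive_eq (is_deriveB dS (IH t)) _; rewrite mulr1.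
Qed.

(** By the mean value theorem a first difference is h times a derivative; since
    differences commute with differentiation this can be repeated k times. *)
Lemma derivs_diffs_le D k m (h t M : R) : derivs D -> 0 <= h ->
  (forall s, t <= s <= t + k%:R * h -> `|D (m + k)%N s| <= M) ->
  `|diffs (nseq k h) (D m) t| <= M * h ^+ k.
Proof.
move=> dD h0; elim: k m t => [|k IH] m t H.
  by rewrite mulr1 -[D m]/(D m) -(addn0 m) H// mul0r addr0 lexx.
rewrite -[nseq _ _]/(h :: nseq k h) diffs_cons.
have th : t <= t + h by rewrite lerDl.
have [] := MVT_segment th (fun s _ => derivs_diffs k m h s dD).
  by apply: derivable_within_continuous => s _; have [] := derivs_diffs k m h s dD.
move=> s; rewrite in_itv /= => /andP[ts sh] ->.
rewrite addrAC subrr add0r normrM (ger0_norm h0) exprSr mulrA.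
apply: ler_wpM2r => //; apply: IH => u /andP[su us].
rewrite addSnnS; apply: H; rewrite (le_trans ts su)/=.
by rewrite -natr1 mulrDl mul1r; lra.
Qed.

Lemma derivs_vanish D (c d : R) : derivs D ->
  (forall t, d <= `|t - c| -> D 0 t = 0) ->
  forall m t, d < `|t - c| -> D m t = 0.
Proof.
move=> dD D0; elim=> [|m IH] t td; first exact/D0/ltW.
have [_ <-] := dD m t.
suff [] : is_derive t 1 (D m) 0 by [].
apply: (@near_eq_is_derive _ _ _ (cst 0)).
near=> s; rewrite IH//.
have : `|t - s| < `|t - c| - d.
  near: s; apply: (@cvgr_dist_lt _ _ _ _ _ id t) => //; rewrite subr_gt0//.
have := ler_normD (t - s) (s - c); rewrite addrA subrK; lra.
Unshelve. all: by end_near. Qed.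

(** The j-th slot is the interval from 1 / (j + 2) to 1 / (j + 1).  The radius is a
    quarter of its length, so that a bump supported within that distance of the
    center vanishes near the ends of the slot, together with its derivatives. *)
Definition slot_center (j : nat) : R := (harmonic j + harmonic j.+1) / 2.
Definition slot_radius (j : nat) : R := (harmonic j - harmonic j.+1) / 4.
Definition slot_out (j : nat) (t : R) := t <= harmonic j.+1 \/ harmonic j <= t.

Lemma harmonic_le (i j : nat) : (i <= j)%N -> harmonic j <= harmonic i :> R.
Proof. by move=> ij; rewrite /= lef_pV2 ?posrE ?ltr0n// ler_nat ltnS. Qed.

Lemma slot_radius_gt0 j : 0 < slot_radius j.
Proof.
by rewrite divr_gt0// subr_gt0 /= ltf_pV2 ?posrE ?ltr0n// ltr_nat.
Qed.

Lemma slot_out_far j t : slot_out j t -> slot_radius j < `|t - slot_center j|.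
Proof.
have := slot_radius_gt0 j; rewrite /slot_radius /slot_center => w0 [H|H].
  by rewrite ltr0_norm; lra.
by rewrite gtr0_norm; lra.
Qed.

(** The only slot whose interior may contain t; a t <= 0 is outside every slot. *)
Definition slot (t : R) : nat := (Num.truncn t^-1).-1.

Lemma slot_out_neq l t : l != slot t -> slot_out l t.
Proof.
have [t0|t0] := leP t 0; first by left; apply: le_trans t0 (harmonic_ge0 _).
have s0 : 0 < t^-1 by rewrite invr_gt0.
rewrite /slot; have /andP[] := truncn_itv (ltW s0); set N := Num.truncn _.
move=> Nl Nu; rewrite neq_ltn => /orP[lN|Nl'].
- left; rewrite /= -[t]invrK lef_pV2 ?posrE ?ltr0n//.
  by apply: le_trans Nl; rewrite ler_nat; case: (N) lN.
- right; rewrite /= -[t]invrK lef_pV2 ?posrE ?ltr0n//.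
  apply: ltW (lt_le_trans Nu _); rewrite ler_nat ltnS.
  by case: (N) Nl'.
Qed.

Section Glue.
Variables (E : nat -> nat -> R -> R) (C : R).
Hypothesis dE : forall j, derivs (E j).
Hypothesis E0 : forall j m t, slot_out j t -> E j m t = 0.
Hypothesis EC : forall j m t, (m <= j)%N -> `|E j m t| <= C * t ^+ 2.

Definition glue (m : nat) (t : R) : R := E (slot t) m t.

Lemma glue_le0 m t : t <= 0 -> glue m t = 0.
Proof. by move=> t0; apply: E0; left; apply: le_trans t0 (harmonic_ge0 _). Qed.

Lemma glue_slot j m t : ~ slot_out j t -> glue m t = E j m t.
Proof.
by move=> jt; rewrite /glue; have [<-//|/slot_out_neq] := eqVneq j (slot t).
Qed.

Lemma glue_sum N m t : harmonic N < t -> glue m t = \sum_(j < N) E j m t.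
Proof.
move=> Nt; have [iN|iN] := ltnP (slot t) N.
  rewrite (bigD1 (Ordinal iN))//= big1 ?addr0// => j ij.
  by apply/E0/slot_out_neq.
rewrite big1 => [|j _].
  by apply: E0; right; apply: le_trans (harmonic_le iN) (ltW Nt).
by apply/E0/slot_out_neq; rewrite neq_ltn (leq_trans (ltn_ord j) iN).
Qed.

(** Away from 0 the glued function is locally a finite sum.  At 0 the quadratic
    bound gives a zero derivative; it holds for the m-th derivatives only in the
    slots j >= m, but the finitely many other slots stay away from 0. *)
Lemma glue_derivs : derivs glue.
Proof.
move=> m t; have [t0|t0|->] := ltgtP t 0.
- rewrite (glue_le0 _ (ltW t0)).
  apply: (@near_eq_is_derive _ _ _ (cst 0)).
  by near=> s; rewrite glue_le0//; near: s; exact: lt_le_nbhsl.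
- have [N Nt] : exists N, harmonic N < t.
    (* The slots with index at least N lie to the left of t. *)
    exists (Num.truncn t^-1); rewrite /= -[t in _ < t]invrK.
    by rewrite ltf_pV2 ?posrE ?ltr0n ?invr_gt0// truncnS_gt.
  rewrite (glue_sum _ Nt).
  apply: (@near_eq_is_derive _ _ _ (\sum_(j < N) E j m)); last first.
    by apply: is_derive_sum => j; exact: dE.
  near=> s; rewrite (@glue_sum N) ?fct_sumE//.
  by near: s; exact: lt_nbhsr.
- rewrite glue_le0//; apply: (@quadratic_is_derive0 _ _ C (harmonic m)).
    exact: harmonic_gt0.
  move=> s sm; have [ms|ms] := leqP m (slot s); first exact: EC.
  rewrite /glue E0 ?normr0.
    have /le_trans := normr_ge0 (E m m s); apply; exact: EC.
  left; apply: le_trans (ler_norm _) (le_trans (ltW sm) _).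
  exact: harmonic_le.
Unshelve. all: by end_near. Qed.

End Glue.

(** A plateau A and its product B with t - slot_center j, with all their
    derivatives, and a size s so small that every combination of A and B with
    coefficients at most s obeys the hypothesis of the gluing on derivatives of
    order at most j. *)
Lemma bump_data (j : nat) (C : R) : 0 < C ->
  exists (ABs : (nat -> R -> R) * (nat -> R -> R) * R),
  let: (A, B, s) := ABs in
  [/\ derivs A, derivs B, 0 < s,
    forall m t, slot_out j t -> A m t = 0 /\ B m t = 0 &
    (forall m t, (m <= j)%N -> s * (`|A m t| + `|B m t|) <= C * t ^+ 2) /\
    (forall t, `|t - slot_center j| <= slot_radius j / 2 ->
      A 0 t = 1 /\ B 0 t = t - slot_center j)].
Proof.
move=> C0.
have [psi [spsi psi1 psi0]] := plateau (slot_center j) (slot_radius_gt0 j).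
have [A dA A0] := smooth1_derivs spsi.
have spsi' : smooth1 (fun t => psi t * (t + - slot_center j)).
  by apply: smooth1_mul spsi _; apply: smooth1_add; [exact: smooth1_id|exact: smooth1_cst].
have [B dB B0] := smooth1_derivs spsi'.
have vA m t : slot_out j t -> A m t = 0.
  move=> /slot_out_far; apply: derivs_vanish => // s sd; rewrite A0; exact: psi0.
have vB m t : slot_out j t -> B m t = 0.
  move=> /slot_out_far; apply: derivs_vanish => // s sd.
  by rewrite B0 psi0// mul0r.
have [M HM] : exists M, 0 <= M /\ forall m t, (m <= j)%N ->
    harmonic j.+1 <= t <= harmonic j -> `|A m t| + `|B m t| <= M.
  elim: {1}j => [|n [M [M0 IH]]].
    have [MA HA] := derivs_bounded 0 dA (harmonic_le (leqnSn j)).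
    have [MB HB] := derivs_bounded 0 dB (harmonic_le (leqnSn j)).
    exists (`|MA| + `|MB|); split=> [|m t]; first by rewrite addr_ge0.
    rewrite leqn0 => /eqP -> tj.
    by apply: lerD; apply: le_trans (ler_norm _); [exact: HA|exact: HB].
  have [MA HA] := derivs_bounded n.+1 dA (harmonic_le (leqnSn j)).
  have [MB HB] := derivs_bounded n.+1 dB (harmonic_le (leqnSn j)).
  exists (M + (`|MA| + `|MB|)); split=> [|m t]; first by rewrite !addr_ge0.
  rewrite leq_eqVlt => /orP[/eqP ->|mn] tj.
    rewrite ler_wpDl//.
    by apply: lerD; apply: le_trans (ler_norm _); [exact: HA|exact: HB].
  by rewrite ler_wpDr ?addr_ge0//; exact: IH.
case: HM => M0 HM.
(* On the j-th slot t >= harmonic j.+1, and outside it A and B vanish. *)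
pose s := C * harmonic j.+1 ^+ 2 / (M + 1).
have h0 : 0 < harmonic j.+1 :> R by exact: harmonic_gt0.
have M1 : 0 < M + 1 by rewrite ltr_wpDl.
have s0 : 0 < s by rewrite divr_gt0// mulr_gt0// exprn_gt0.
exists (A, B, s); split=> //.
  by move=> m t jt; rewrite vA// vB.
split=> [m t mj|t tj]; last first.
  by rewrite A0 B0 psi1// mul1r.
have [tl|tl] := leP t (harmonic j.+1).
  rewrite vA; last by left.
  rewrite vB; last by left.
  by rewrite normr0 addr0 mulr0 mulr_ge0 ?sqr_ge0// ltW.
have [tr|tr] := leP (harmonic j) t.
  rewrite vA; last by right.
  rewrite vB; last by right.
  by rewrite normr0 addr0 mulr0 mulr_ge0 ?sqr_ge0// ltW.
have /(HM m t mj) H : harmonic j.+1 <= t <= harmonic j by rewrite !ltW.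
apply: le_trans (_ : s * (M + 1) <= _).
  by rewrite ler_pM2l//; apply: le_trans H _; rewrite lerDl.
rewrite /s divfK ?gt_eqF// ler_pM2l//.
by apply: lerXn2r; rewrite ?nnegrE ltW// (lt_trans h0).
Qed.

Lemma le_coord_norm n (v : 'rV[R]_n) i : `|v 0 i| <= `|v|.
Proof.
rewrite [leRHS]/Num.norm /= mx_normrE.
exact: (le_bigmax _ (fun ij : 'I_1 * 'I_n => `|v ij.1 ij.2|) (0, i)).
Qed.

Lemma norm_le_coord n (v : 'rV[R]_n) (C : R) : 0 <= C ->
  (forall i, `|v 0 i| <= C) -> `|v| <= C.
Proof.
move=> C0 H; rewrite [leLHS]/Num.norm /= mx_normrE.
by apply: bigmax_le => // -[i k] _ /=; rewrite (ord1 i).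
Qed.

(** Any choice of points x + a_j and velocities b_j that are smaller than the
    sizes s_j, which depend on C only, is realised by a single smooth curve: the
    curve is affine with these data near each slot center. *)
Lemma special_curve n (x : 'rV[R]_n) (C : R) : 0 < C ->
  exists2 s : nat -> R, forall j, 0 < s j &
  forall a b : nat -> 'rV[R]_n,
    (forall j, `|a j| <= s j) -> (forall j, `|b j| <= s j) ->
  exists c : R -> 'rV[R]_n,
    [/\ forall i, smooth1 (fun t => c t 0 i), forall t, `|c t - x| <= C &
      forall j t, `|t - slot_center j| <= slot_radius j / 2 ->
        c t = x + (a j + (t - slot_center j) *: b j)].
Proof.
move=> C0; have [ABs H] := choice (fun j => bump_data j C0).
pose A j := (ABs j).1.1; pose B j := (ABs j).1.2; pose s j := (ABs j).2.
have {}H j : [/\ derivs (A j), derivs (B j), 0 < s j,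
    forall m t, slot_out j t -> A j m t = 0 /\ B j m t = 0 &
    (forall m t, (m <= j)%N -> s j * (`|A j m t| + `|B j m t|) <= C * t ^+ 2) /\
    (forall t, `|t - slot_center j| <= slot_radius j / 2 ->
      A j 0 t = 1 /\ B j 0 t = t - slot_center j)].
  by have := H j; rewrite /A /B /s; case: (ABs j) => [[? ?] ?].
exists s => [j|a b Ha Hb]; first by have [] := H j.
pose E i j m t := a j 0 i * A j m t + b j 0 i * B j m t.
have dE i j : derivs (E i j).
  move=> m t; have [dA dB _ _ _] := H j.
  exact: is_deriveD (is_deriveZ (a j 0 i) (dA m t)) (is_deriveZ (b j 0 i) (dB m t)).
have E0 i j m t : slot_out j t -> E i j m t = 0.
  by have [_ _ _ v _] := H j => /(v m)[Av Bv]; rewrite /E Av Bv !mulr0 addr0.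
have EC i j m t : (m <= j)%N -> `|E i j m t| <= C * t ^+ 2.
  move=> mj; have [_ _ _ _ [HC _]] := H j.
  apply: le_trans (HC m t mj); rewrite mulrDr.
  apply: le_trans (ler_normD _ _) _; rewrite !normrM.
  apply: lerD; apply: ler_wpM2r => //.
    exact: le_trans (le_coord_norm _ _) (Ha j).
  exact: le_trans (le_coord_norm _ _) (Hb j).
have dG i := glue_derivs (dE i) (E0 i) (EC i).
exists (fun t => x + \row_i glue (E i) 0 t); split.
- move=> i; under eq_fun => t do rewrite !mxE.
  exact: smooth1_add (smooth1_cst (x 0 i)) (derivs_smooth1 0 (dG i)).
- move=> t; rewrite [x + _]addrC addrK; apply: norm_le_coord => [|i]; first exact: ltW.
  rewrite mxE; have [t0|t0] := leP t 0.
    by rewrite (glue_le0 (E0 i))// normr0 ltW.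
  have [t1|t1] := leP 1 t.
    rewrite /glue E0 ?normr0 ?ltW//; right; apply: le_trans t1.
    by rewrite invf_le1 ?ltr0n// ler1n.
  apply: le_trans (EC _ _ _ _ (leq0n _)) _.
  by rewrite ler_piMr ?(ltW C0)// expr_le1 ?ltW.
- move=> j t jt; congr (_ + _); apply/rowP => i; rewrite !mxE.
  have nout : ~ slot_out j t.
    by move=> /slot_out_far; rewrite ltNge => /negP; apply; have := slot_radius_gt0 j; lra.
  rewrite (glue_slot _ _ nout) /E.
  by have [_ _ _ _ [_ /(_ t jt)[-> ->]]] := H j; rewrite mulr1 mulrC.
Qed.

End SpecialCurve.

(** * Boman's theorem *)

Section Boman.
Variable R : realType.

Lemma diffs_affine (V W : normedModType R) (phi : V -> R) (f : W -> R)
    (t h : V) (y w : W) k :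
  (forall i, (i <= k)%N -> phi (t + i%:R *: h) = f (y + i%:R *: w)) ->
  diffs (nseq k h) phi t = diffs (nseq k w) f y.
Proof.
elim: k t y => [|k IH] t y H; first by have := H 0 isT; rewrite !scale0r !addr0.
rewrite !diffs_nseqS; congr (_ - _); apply: IH => i ik; last exact/H/leqW.
by have := H i.+1 ik; rewrite -natr1 !scalerDl !scale1r !(addrC (_ *: _)) !addrA.
Qed.

(** Suppose that the differences of f with a repeated step are not O(|w|^k) near x.
    In slot j choose a failing pair (y, w) for the constant j / s_j^k and for a
    radius that lets all the points y + i w, i <= k, lie on the affine piece of
    the special curve c with point y and velocity s_j w / |w|.  The k-th
    difference of f \o c with step eta_j = |w| / s_j then exceeds j eta_j^k,
    which is impossible for j at least the maximum of its k-th derivative. *)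
Theorem boman n (U : set 'rV[R]_n) (g : U -> R) : open U ->
  (forall F : [set: 'rV[R]_1] -> U, smooth_map F -> smooth_on (g \o F)) ->
  smooth_on g.
Proof.
move=> oU gF k; apply: tame_Ck => //; apply: tame_of_diag => x Ux {}k.
set f := 'valL_(0 : R) g.
have [C C0 xC] : exists2 C : R, 0 < C & forall y, `|y - x| <= C -> U y.
  have /nbhs_ballP[e /= e0 xe] := open_nbhs_nbhs (conj oU Ux).
  exists (e / 2) => [|y yx]; first exact: divr_gt0.
  by apply: xe; rewrite -ball_normE /= distrC; apply: le_lt_trans yx _; lra.
have [s s0 Hs] := special_curve x C0.
have w0 (j : nat) : 0 < slot_radius R j := slot_radius_gt0 R j.
have k0 : 0 < k.+1%:R :> R by rewrite ltr0n.
pose r j := Num.min (s j) (s j * (slot_radius R j / 2) / k.+1%:R).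
have r0 j : 0 < r j by rewrite lt_min s0 divr_gt0// mulr_gt0// divr_gt0.
apply: contrapT => nH.
have /choice[yw Hyw] (j : nat) : exists yw : 'rV[R]_n * 'rV[R]_n,
    [/\ `|yw.1 - x| <= r j, `|yw.2| <= r j &
      j%:R / s j ^+ k * `|yw.2| ^+ k < `|diffs (nseq k yw.2) f yw.1|].
  apply: contrapT => nj; apply: nH; exists (r j), (j%:R / s j ^+ k); split=> //.
  move=> y w yx wr; rewrite leNgt; apply/negP => H; apply: nj.
  by exists (y, w).
pose y j := (yw j).1; pose w j := (yw j).2.
pose eta j := `|w j| / s j.
(* For w j = 0 this is the zero velocity, and eta j = 0. *)
pose b j := s j *: (`|w j|^-1 *: w j).
have bE j : eta j *: b j = w j.
  rewrite /eta /b !scalerA mulfVK ?gt_eqF//.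
  have [->|wj] := eqVneq (w j) 0; first by rewrite scaler0.
  by rewrite divff ?scale1r// normr_eq0.
have [c [sc cC cE]] : exists c : R -> 'rV[R]_n,
    [/\ forall i, smooth1 (fun t => c t 0 i), forall t, `|c t - x| <= C &
      forall j t, `|t - slot_center R j| <= slot_radius R j / 2 ->
        c t = x + ((y j - x) + (t - slot_center R j) *: b j)].
  apply: Hs => j.
    by have [+ _ _] := Hyw j => /le_trans; apply; rewrite ge_min lexx.
  rewrite normrZ (gtr0_norm (s0 j)) ler_piMr ?(ltW (s0 j))//.
  rewrite normrZ normfV normr_id.
  have [->|wj] := eqVneq (w j) 0; first by rewrite normr0 mulr0.
  by rewrite mulVf// normr_eq0.
pose F (v : [set: 'rV[R]_1]) : U := exist _ (c (val v 0 0)) (mem_set (xC _ (cC _))).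
have inT (z : 'rV[R]_1) : z \in [set: 'rV[R]_1] by rewrite inE.
pose pt z : [set: 'rV[R]_1] := exist _ z (inT z).
have smF : smooth_map F.
  move=> i m; apply: (Ck_eq openT _ (sc i m)) => z _.
  by rewrite -[z in RHS]/(val (pt z)) valL_in.
have [D dD D0] := smooth_derivs (gF F smF).
have {}D0 t : D 0 t = f (c t).
  have -> : c t = val (F (pt (const_mx t))) by rewrite /= mxE.
  by rewrite D0 -[const_mx t in LHS]/(val (pt (const_mx t))) /f !valL_in.
have [M HM] := derivs_bounded k dD ler01.
pose j := (Num.truncn M).+1.
have Mj : M <= j%:R by apply/ltW/truncnS_gt.
have eta0 : 0 <= eta j by rewrite divr_ge0 ?(ltW (s0 j)).
have [_ wr big] := Hyw j; rewrite -/(y j) -/(w j) in wr big.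
have keta : k%:R * eta j <= slot_radius R j / 2.
  have : `|w j| <= s j * (slot_radius R j / 2) / k.+1%:R.
    by apply: le_trans wr _; rewrite ge_min lexx orbT.
  rewrite ler_pdivlMr// [s j * _]mulrC -ler_pdivrMr// mulrAC -/(eta j) mulrC.
  by apply: le_trans; rewrite ler_wpM2r// ler_nat.
have E : diffs (nseq k (eta j)) (D 0) (slot_center R j) = diffs (nseq k (w j)) f (y j).
  apply: diffs_affine => i ik; rewrite D0 (cE j).
    rewrite [slot_center R j + _]addrC addrK addrA subrKC; congr (f (_ + _)).
    by rewrite -[_ *: eta j]/(_ * eta j) -scalerA bE.
  rewrite [slot_center R j + _]addrC addrK normrM normr_nat (ger0_norm eta0).
  by apply: le_trans keta; rewrite ler_wpM2r// ler_nat.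
have : `|diffs (nseq k (eta j)) (D 0) (slot_center R j)| <= M * eta j ^+ k.
  apply: derivs_diffs_le => // t /andP[t0 t1]; apply: HM.
  have h0 : 0 < harmonic j.+1 :> R := harmonic_gt0 _.
  have h1 : harmonic j <= 1 :> R by rewrite invf_le1 ?ltr0n// ler1n.
  have := w0 j; move: t0 t1 keta; rewrite /slot_center /slot_radius => *.
  by apply/andP; split; lra.
rewrite E leNgt => /negP; apply; apply: le_lt_trans big.
rewrite -mulrA -[X in _ <= _ * X]mulrC -expr_div_n.
by rewrite ler_wpM2r// exprn_ge0.
Qed.

End Boman.

(** * Functions smooth along the curves of a diffeology *)

(** A plot followed along a smooth curve of its domain is a curve of the
    diffeology, so Boman's theorem applies to the composite with the plot. *)
Lemma PhiC_curves_of (R : realType) (X : Type) (D : set (param R X)) :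
  is_diffeology D -> PhiC (curves_of D) = Phi D.
Proof.
move=> [_ _ Dcomp]; apply/seteqP; split=> [f Hf p Dp|f Hf _ [c Dc <-]]; last exact: Hf.
apply: (boman (@pdom_open R X p)) => F sF.
have inT (z : 'rV[R]_1) : z \in [set: 'rV[R]_1] by rewrite inE.
pose c (t : R) := p (F (exist _ (const_mx t) (inT (const_mx t)))).
have cE : Param openT (p \o F) = curve c.
  congr (Param openT _); apply/funext => v; rewrite /c /=; congr (p (F _)).
  by apply/val_inj => /=; rewrite -rV1E.
have fc (q : param R X) : q = curve c -> smooth_on (f \o q).
  by move=> ->; apply: Hf; exists c => //; rewrite /curves_of /= -cE; exact: Dcomp.
exact: (fc _ cE).
Qed.

(** * Isomorphism of categories *)

Lemma existT_inj (T : Type) (P : T -> Type) (x : T) (a b : P x) :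
  existT P x a = existT P x b -> a = b.
Proof.
move=> E; have /= := projT2_eq E.
by rewrite (Prop_irrelevance (projT1_eq E) (erefl x)).
Qed.

(** Equality of functors on morphisms is stated in the total space of morphisms,
    since the two sides have different types until the functors are known to
    agree on objects. *)
Lemma functor_eq (C D : category) (F G : functor C D) :
  (forall a b (f : mor a b),
     existT (fun p : obj D * obj D => mor p.1 p.2) (F a, F b) (Defs.fmap F f) =
     existT (fun p : obj D * obj D => mor p.1 p.2) (G a, G b) (Defs.fmap G f)) ->
  F = G.
Proof.
case: F G => [F Fm Fi Fc] [G Gm Gi Gc] /= H.
have FG : F = G.
  by apply/funext => a; have [] := existT_inj1 (H a a (idmor a)).
case: _ / FG in Gm Gi Gc H *.
have FGm : Fm = Gm.
  apply: functional_extensionality_dep => a; apply: functional_extensionality_dep => b.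
  by apply/funext => f; exact: existT_inj (H a b f).
case: _ / FGm in Gi Gc *.
by congr Functor; exact: Prop_irrelevance.
Qed.

Section Morphisms.
Variable R : realType.

Lemma diffeological_morphism_eq (X Y : Type) (iX : inhabited X) (iY : inhabited Y)
    (DX DX' : set (param R X)) (DY DY' : set (param R Y)) dX dX' rX rX' dY dY' rY rY'
    (A := @ReflexiveDiffeological R X iX DX dX rX : ReflDiffeol R)
    (A' := @ReflexiveDiffeological R X iX DX' dX' rX' : ReflDiffeol R)
    (B := @ReflexiveDiffeological R Y iY DY dY rY : ReflDiffeol R)
    (B' := @ReflexiveDiffeological R Y iY DY' dY' rY' : ReflDiffeol R)
    (F : X -> Y) (sF : @diffeologically_smooth R A B F)
    (sF' : @diffeologically_smooth R A' B' F) :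
  DX = DX' -> DY = DY' ->
  existT (fun p : ReflDiffeol R * ReflDiffeol R => mor p.1 p.2) (A, B) (exist _ F sF) =
  existT (fun p : ReflDiffeol R * ReflDiffeol R => mor p.1 p.2) (A', B') (exist _ F sF').
Proof.
move=> EX EY; subst DX' DY'; rewrite /A /A' /B /B' in sF sF' *.
move: sF'; rewrite -(Prop_irrelevance dX dX') -(Prop_irrelevance rX rX').
rewrite -(Prop_irrelevance dY dY') -(Prop_irrelevance rY rY') => sF'.
by rewrite (Prop_irrelevance sF sF').
Qed.

Lemma frolicher_morphism_eq (X Y : Type) (iX : inhabited X) (iY : inhabited Y)
    (CX CX' : set (R -> X)) (FX FX' : set (X -> R))
    (CY CY' : set (R -> Y)) (FY FY' : set (Y -> R)) pX pX' gX gX' pY pY' gY gY'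
    (A := @Frolicher R X iX CX FX pX gX : Frol R)
    (A' := @Frolicher R X iX CX' FX' pX' gX' : Frol R)
    (B := @Frolicher R Y iY CY FY pY gY : Frol R)
    (B' := @Frolicher R Y iY CY' FY' pY' gY' : Frol R)
    (F : X -> Y) (sF : @frolicher_smooth R A B F)
    (sF' : @frolicher_smooth R A' B' F) :
  CX = CX' -> CY = CY' ->
  existT (fun p : Frol R * Frol R => mor p.1 p.2) (A, B) (exist _ F sF) =
  existT (fun p : Frol R * Frol R => mor p.1 p.2) (A', B') (exist _ F sF').
Proof.
move=> EX EY.
have EFX : FX = FX' by rewrite -pX -pX' EX.
have EFY : FY = FY' by rewrite -pY -pY' EY.
rewrite {}/A {}/A' {}/B {}/B' in sF sF' *.
case: _ / EX in pX' gX' sF' *; case: _ / EY in pY' gY' sF' *.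
case: _ / EFX in pX' gX' sF' *; case: _ / EFY in pY' gY' sF' *.
move: sF'; rewrite -(Prop_irrelevance pX pX') -(Prop_irrelevance gX gX').
rewrite -(Prop_irrelevance pY pY') -(Prop_irrelevance gY gY') => sF'.
by rewrite (Prop_irrelevance sF sF').
Qed.

End Morphisms.

Theorem theorem2p57 (R : realType) :
  inverse_functors (Lambda R) (comp_functor (Pi_functor R) (Xi R)).
Proof.
split; apply: functor_eq.
  have plots (Z : ReflDiffeol R) : Pi (PhiC (curves_of (@rd_plots R Z))) = @rd_plots R Z.
    by rewrite PhiC_curves_of ?rd_reflexive//; exact: rd_diffeology.
  move=> X Y F; have := plots X; have := plots Y.
  case: X Y F => [X iX DX dX rX] [Y iY DY dY rY] [F sF] eY eX.
  exact: diffeological_morphism_eq eX eY.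
move=> X Y F.
have := @fr_Gamma R X; have := @fr_Gamma R Y.
case: X Y F => [X iX CX FX pX gX] [Y iY CY FY pY gY] [F sF] eY eX.
exact: frolicher_morphism_eq eX eY.
Qed.
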